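(* Let $n\geq 3$ and let $\ell=(l_1,\ldots,l_n)\in\textup{int}(C_n)$. Then the directed system \[M_2(\ell)\xrightarrow{\varphi_2} M_3(\ell)\xrightarrow{\varphi_3} M_4(\ell)\xrightarrow{\varphi_4}\cdots \xrightarrow{\varphi_{d-1}} M_d(\ell) \xrightarrow{\varphi_d}\cdots\] of moduli spaces of $\ell$-gons stabilizes at $d=n$, that is, $M_d(\ell)$ is homeomorphic to $M_n(\ell)$ if and only if $d\geq n$.
   Context: For $n\geq 3$, $\ell=(l_1,\ldots,l_n)$ with all $l_i>0$, and $d\geq 2$, the polygon space is $V_d(\ell)=\{(\mathbf{v}_1,\ldots,\mathbf{v}_{n-1})\in(\mathbb{R}^d)^{n-1} : \|\mathbf{v}_i-\mathbf{v}_{i-1}\|=l_i,\ i=1,\ldots,n\}$, where $\mathbf{v}_0=\mathbf{v}_n=\mathbf{0}$; $SO(d)$ acts on it diagonally, and $M_d(\ell)=V_d(\ell)/SO(d)$ with quotient topology, $[P]$ denoting the class of $P$. $C_n$ is the set of $\ell\in\mathbb{R}^n$ with $l_i>0$ and $l_i\leq\sum_{j\neq i}l_j$ for all $i$; $\textup{int}(C_n)$ is its interior in $\mathbb{R}^n$ (i.e. all inequalities strict). Fix linear Euclidean isometries $f_d:\mathbb{R}^d\to\mathbb{R}^{d+1}$ for $d\geq 2$; let $F_d:V_d(\ell)\to V_{d+1}(\ell)$, $(\mathbf{v}_1,\ldots,\mathbf{v}_{n-1})\mapsto(f_d(\mathbf{v}_1),\ldots,f_d(\mathbf{v}_{n-1}))$,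 and $\varphi_d:M_d(\ell)\to M_{d+1}(\ell)$, $[P]\mapsto[F_d(P)]$. *)

(* Defs.v *)
From HB Require Import structures.
From mathcomp Require Import all_boot all_order all_algebra.
From mathcomp Require Import generic_quotient.
From mathcomp Require Import all_classical all_reals.
From mathcomp Require Import topology_structure num_topology matrix_topology subtype_topology
  quotient_topology.

Set Implicit Arguments.
Unset Strict Implicit.
Unset Printing Implicit Defensive.

Import Order.TTheory GRing.Theory Num.Theory.
Import numFieldTopology.Exports.
Local Open Scope classical_set_scope.
Local Open Scope ring_scope.

Section Polygon.
Variable R : realType.

Definition eucl_norm (d : nat) (v : 'rV[R]_d) : R :=
  Num.sqrt (\sum_(j < d) v ord0 j ^+ 2).

(* A configuration P = (v_1, ..., v_{n-1}) in (R^d)^{n-1} is stored as the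
   (n-1) x d matrix whose row k is v_{k+1}.  vtx P i is the vertex v_i, with
   the convention v_0 = v_n = 0 (and 0 beyond). *)
Definition vtx (n d : nat) (P : 'M[R]_(n.-1, d)) (i : nat) : 'rV[R]_d :=
  match insub i.-1 : option 'I_(n.-1) with
  | Some k => if (0 < i)%N then row k P else 0
  | None => 0
  end.

(* V_d(l): edge i (1 <= i <= n, stored as 0-based index k = i-1 : 'I_n)
   joins v_{i-1} and v_i and has length l_i. *)
Definition Vset (n : nat) (l : 'I_n -> R) (d : nat) : set 'M[R]_(n.-1, d) :=
  [set P | forall k : 'I_n,
      eucl_norm (vtx P k.+1 - vtx P k) = l k].


Definition SO (d : nat) : set 'M[R]_d :=
  [set Q | Q^T *m Q = 1%:M /\ \det Q = 1].


(* Diagonal action of Q in SO(d): v_i |-> Q v_i, i.e. P |-> P *m Q^T on rows. *)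
Definition act (m d : nat) (Q : 'M[R]_d) (P : 'M[R]_(m, d)) : 'M[R]_(m, d) :=
  P *m Q^T.

Definition Vtype (n : nat) (l : 'I_n -> R) (d : nat) : topologicalType := set_type (@Vset n l d).

Definition orbit_rel (n : nat) (l : 'I_n -> R) (d : nat) (x y : Vtype l d) : bool :=
  `[< exists2 Q, @SO d Q & set_val y = act Q (set_val x) >].

Lemma orbit_rel_refl n l d : reflexive (@orbit_rel n l d).
Proof.
move=> x; apply/asboolP; exists 1%:M; last by rewrite /act trmx1 mulmx1.
by split; [rewrite trmx1 mulmx1 | rewrite det1].
Qed.

Lemma orbit_rel_sym n l d : symmetric (@orbit_rel n l d).
Proof.
suff H : forall x y : Vtype l d, orbit_rel x y -> orbit_rel y x.
  by move=> x y; apply/idP/idP; apply: H.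
move=> x y /asboolP [Q QS e]; have [QQ dQ] : Q^T *m Q = 1%:M /\ \det Q = 1 := QS.
apply/asboolP; exists Q^T.
  split; first by rewrite trmxK; apply: mulmx1C.
  by rewrite det_tr.
by rewrite e /act trmxK -mulmxA QQ mulmx1.
Qed.

Lemma orbit_rel_trans n l d : transitive (@orbit_rel n l d).
Proof.
move=> y x z /asboolP [Q QS e1] /asboolP [S SS' e2].
have [QQ dQ] : Q^T *m Q = 1%:M /\ \det Q = 1 := QS.
have [SS dS] : S^T *m S = 1%:M /\ \det S = 1 := SS'.
apply/asboolP; exists (S *m Q).
  split; last by rewrite det_mulmx dQ dS mulr1.
  by rewrite trmx_mul -mulmxA (mulmxA S^T) SS mul1mx QQ.
by rewrite e2 e1 /act trmx_mul mulmxA.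
Qed.

Definition orbit_equiv n l d : equiv_rel (Vtype l d) :=
  EquivRel (@orbit_rel n l d) (@orbit_rel_refl n l d)
    (@orbit_rel_sym n l d) (@orbit_rel_trans n l d).

Local Open Scope quotient_scope.
Definition Mspace (n : nat) (l : 'I_n -> R) (d : nat) : topologicalType :=
  quotient_topology {eq_quot (@orbit_equiv n l d)}.

Definition int_Cn (n : nat) (l : 'I_n -> R) : Prop :=
  forall i : 'I_n, 0 < l i /\ l i < \sum_(j < n | j != i) l j.

End Polygon.

Definition homeomorphic (X Y : topologicalType) : Prop :=
  exists (f : X -> Y) (g : Y -> X),
    [/\ continuous f, continuous g, cancel f g & cancel g f].

(* Main.v *)
Require Import Defs.
From HB Require Import structures.
From mathcomp Require Import all_boot all_order all_algebra.
From mathcomp Require Import fingroup perm generic_quotient.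
From mathcomp Require Import all_classical all_reals.
From mathcomp Require Import topology_structure num_topology matrix_topology subtype_topology
  quotient_topology.
From mathcomp Require Import topology normedtype derive.
From mathcomp Require Import zify ring lra.

(* Rotations preserve exactly the Gram matrix of a configuration P of n - 1
   vectors, so for d >= n the space M_d is the compact convex set K of
   positive semidefinite matrices satisfying the (affine) edge length
   equations, whatever d is.  K contains a nondegenerate matrix c, hence it is
   a ball in its affine span, {gauge <= 1} for the gauge centred at c, with
   boundary sphere {gauge = 1} = {det = 0}, and by Brouwer it has the fixed
   point property.

   M_{n-1} is the double of K along its boundary, that is the sphere
   gauge v + |s| = 1, where the sign of s is that of det P; the antipode
   (v, s) |-> - (v, s) / (gauge (- v) + |s|) has no fixed point, so M_{n-1} is
   not homeomorphic to K.

   For d < n - 1 all Gram matrices are singular, so a homeomorphism K -> M_d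
   composed with the Gram map sends K to its boundary sphere.  The fibres of
   the Gram map are {x, s x} with s the reflection involution, so this map is
   injective on some small ball, which is impossible for dimension reasons.

   Both Brouwer-type statements follow from the existence of a zero of any
   continuous self-map of R^N at bounded distance from the identity, which is
   obtained from a lattice version by compactness. *)

Set Implicit Arguments.
Unset Strict Implicit.
Unset Printing Implicit Defensive.
Import Order.TTheory GRing.Theory Num.Def Num.Theory.
Import numFieldNormedType.Exports.
Local Open Scope classical_set_scope.
Local Open Scope ring_scope.
Local Open Scope quotient_scope.

(** * A cubical Sperner lemma *)

(** The spaces are told apart without homology: the fixed point property and local injectivity are
    both reduced to one existence theorem for zeros. In its lattice version, rainbow simplices are
    counted with sign; the count depends only on the labels on the boundary of the grid, so it can
    be read off a labelling that models the identity.

    The threshold d = n comes from determinants. Equal Gram matrices yield an orthogonal matrix of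
    determinant 1 or -1, and the sign can be corrected by a reflection fixing all vertices exactly
    when these do not span the space. For n - 1 vertices this is automatic if d >= n; if d = n - 1
    it happens only where the Gram determinant vanishes, so two copies of K are glued there.

    For d < n - 1 the topology of M_d is not described; only the two-point bound on the fibres is
    used. An injection of a ball of R^(N+1) into R^N is excluded through a Lipschitz approximate
    left inverse: by the zero theorem it would map a bounded part of R^N onto a ball of R^(N+1),
    against a count of grid points. *)

Section Sperner.
Variables N' p' : nat.
Let N := N'.+1.
Let p := p'.+1.
Implicit Types (z : 'I_N -> nat) (s : 'S_N) (lab : ('I_N -> nat) -> 'I_N.+1).

(* The Kuhn simplex of the cube at z that increments coordinate i at time s i. *)
Definition kuhn_vertex z s (k : nat) : 'I_N -> nat := fun i => (z i + (s i < k))%N.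

(** Nonzero only if the vertices other than [k] carry the labels 0, ..., N-1, each once; it is then
    the sign of that permutation. *)
Definition facet_det lab z s (k : 'I_N.+1) : int :=
  \det (\matrix_(i < N, j < N) ((lab (kuhn_vertex z s (lift k i)) == j :> nat)%:R : int)).

(** The column of ones is the sum of all N+1 indicator columns of the labels, so the determinant is
    that of the full incidence matrix, while its expansion along this column runs over the
    facets. *)
Definition simplex_mx lab z s : 'M[int]_N.+1 :=
  \matrix_(k, j) (if j == ord_max then 1 else (lab (kuhn_vertex z s k) == j)%:R).

Definition nat_pt (z : {ffun 'I_N -> 'I_p}) : 'I_N -> nat := fun i => z i.

(* Only rainbow simplices (those carrying all labels) contribute, so this is
   their signed number. *)
Definition label_degree lab : int :=
  \sum_(z : {ffun 'I_N -> 'I_p}) \sum_(s : 'S_N)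
    (-1) ^+ s * \det (simplex_mx lab (nat_pt z) s).

Lemma det_simplex lab z s :
  \det (simplex_mx lab z s) = \sum_(k < N.+1) (-1) ^+ (k + N) * facet_det lab z s k.
Proof.
rewrite (expand_det_col _ ord_max); apply: eq_bigr => k _.
rewrite mxE eqxx mul1r /cofactor /facet_det; congr (_ * \det _).
apply/matrixP => i j; rewrite !mxE.
have -> : (lift ord_max j == ord_max :> 'I_N.+1) = false by apply/negbTE; rewrite eq_sym neq_lift.
by congr (nat_of_bool _)%:R; rewrite -[RHS]/(_ == _) -(lift_max j).
Qed.

(* An inner facet of a cube is shared by two simplices of opposite orientation. *)
Lemma facet_det_swap lab z (k : 'I_N.+1) : (0 < k < N)%N ->
  \sum_(s : 'S_N) (-1) ^+ s * facet_det lab z s k = 0.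
Proof.
case/andP => k0 kN.
have k1N : (k.-1 < N)%N by apply: leq_ltn_trans kN; apply: leq_pred.
pose a := Ordinal k1N; pose b := Ordinal kN.
have ab : a != b by rewrite -val_eqE /=; case: (k : nat) k0 => // q _; rewrite neq_ltn ltnSn.
(* Exchanging the times k-1 and k alters only vertex [k], which the facet omits. *)
pose t := tperm a b.
set S := LHS; have : S = - S.
  rewrite {1}/S (reindex_inj (mulIg t)) /= /S -sumrN; apply: eq_bigr => s _.
  rewrite odd_permM odd_tperm ab signr_addb expr1 mulrN1 mulNr; congr (- (_ * _)).
  congr (\det _); apply/matrixP => i j; rewrite !mxE.
  have -> // : kuhn_vertex z (s * t)%g (lift k i) = kuhn_vertex z s (lift k i).
  apply: funext => u; rewrite /kuhn_vertex permM; congr (_ + nat_of_bool _)%N.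
  have : (lift k i != k :> nat) by rewrite eq_sym neq_bump.
  move: (lift k i : nat) => q qk.
  rewrite /t; case: tpermP => [->|->|//] /=.
    by move: k0 qk; lia.
  by move: k0 qk; lia.
by move/eqP; rewrite -addr_eq0 -mulr2n mulrn_eq0 /= => /eqP.
Qed.

Let cyc : 'S_N := lift_perm ord0 ord_max 1.

(* The first facet of a simplex is the last facet of a simplex of the next cube. *)
Lemma facet_det_cyc lab z s :
  facet_det lab z s ord0 =
  facet_det lab (fun i => z i + (s i == ord0))%N (s * cyc)%g ord_max.
Proof.
congr (\det _); apply/matrixP => i j; rewrite !mxE.
suff -> : kuhn_vertex z s (lift ord0 i) =
  kuhn_vertex (fun i => z i + (s i == ord0))%N (s * cyc)%g (lift ord_max i) by [].
apply: funext => u; rewrite /kuhn_vertex permM.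
rewrite lift_max lift0 -addnA; congr (_ + _)%N.
case: (unliftP ord0 (s u)) => [w|] -> /=.
  rewrite /cyc lift_perm_lift perm1 lift_max /bump; lia.
have -> : cyc ord0 = ord_max by exact: lift_perm_id.
by rewrite /= ltnNge -ltnS ltn_ord.
Qed.

Let diff lab1 lab2 z s := facet_det lab1 z s ord_max - facet_det lab2 z s ord_max.

(** Inner facets cancel. Through [cyc], first and last facets become values of one function at
    neighbouring cubes, so each permutation contributes a discrete derivative in the direction of
    the coordinate it increments first. *)
Lemma label_degree_diff lab1 lab2 : label_degree lab1 - label_degree lab2 =
  (-1) ^+ N * \sum_(s : 'S_N) (-1) ^+ s *
    \sum_(z : {ffun 'I_N -> 'I_p})
     (diff lab1 lab2 (fun i => z i + (s i == ord0))%N (s * cyc)%g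
      - diff lab1 lab2 (nat_pt z) (s * cyc)%g).
Proof.
have E lab z : \sum_(s : 'S_N) (-1) ^+ s * \det (simplex_mx lab z s) =
   (-1) ^+ N * \sum_(s : 'S_N) (-1) ^+ s *
    (facet_det lab (fun i => z i + (s i == ord0))%N (s * cyc)%g ord_max
      - facet_det lab z (s * cyc)%g ord_max).
  under eq_bigr do rewrite det_simplex mulr_sumr.
  rewrite exchange_big /= (bigD1 ord0) //= (bigD1 ord_max) //=.
  rewrite [X in _ + (_ + X)]big1 ?addr0; last first.
    move=> k /andP[k0 kN]; under eq_bigr do rewrite mulrCA.
    rewrite -mulr_sumr facet_det_swap ?mulr0 // lt0n; apply/andP; split.
      by rewrite -val_eqE in k0.
    by rewrite ltn_neqAle -ltnS ltn_ord andbT; rewrite -val_eqE in kN.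
  have sc s : (-1) ^+ (s * cyc)%g = (-1) ^+ s * (-1) ^+ N' :> int.
    by rewrite odd_permM odd_lift_perm odd_perm1 addbF /= signr_addb signr_odd.
  rewrite [X in _ + X](reindex_inj (mulIg cyc)) /=.
  rewrite -big_split mulr_sumr; apply: eq_bigr => s _ /=.
  rewrite facet_det_cyc sc add0n addnn -mul2n exprM sqrrN !expr1n mul1r /N exprS.
  move: (facet_det _ _ _ _) (facet_det _ _ _ _) ((-1) ^+ N') ((-1) ^+ s) => u v e e'.
  by ring.
rewrite /label_degree -sumrB; under eq_bigr do rewrite !E -mulrBr -sumrB.
rewrite -mulr_sumr; congr (_ * _); rewrite exchange_big /=; apply: eq_bigr => s _.
rewrite mulr_sumr; apply: eq_bigr => z _; rewrite -mulrBr /diff; congr (_ * _).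
by rewrite !opprB addrACA [RHS]addrACA; congr (_ + _); rewrite addrC.
Qed.

Definition on_boundary (x : 'I_N -> nat) : bool :=
  [exists i, (x i == 0%N) || (x i == p)].

(** The discrete derivatives telescope, and the end terms are facets lying in a face [x i0 = 0] or
    [x i0 = p]: coordinate [i0] is incremented last under [s * cyc], hence constant on the last
    facet. *)
Lemma label_degree_boundary lab1 lab2 :
  (forall x, on_boundary x -> lab1 x = lab2 x) ->
  label_degree lab1 = label_degree lab2.
Proof.
move=> bE; apply/eqP; rewrite -subr_eq0 label_degree_diff; apply/eqP.
rewrite big1 ?mulr0 // => s _.
rewrite [X in _ * X](_ : _ = 0) ?mulr0 //.
set i0 := (s^-1)%g ord0.
have E0 z : (z i0 == 0%N) || (z i0 == p) -> diff lab1 lab2 z (s * cyc)%g = 0.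
  move=> zb; apply/eqP; rewrite /diff subr_eq0; apply/eqP.
  congr (\det _); apply/matrixP => i j; rewrite !mxE.
  rewrite bE //; apply/existsP; exists i0.
  have ci : (s * cyc)%g i0 = ord_max by rewrite permM permKV; exact: lift_perm_id.
  have iN : (N' < lift ord_max i)%N = false by rewrite lift_max ltnNge -ltnS ltn_ord.
  by rewrite /kuhn_vertex ci iN addn0.
(* The sum over z telescopes along coordinate i0; since the summands vanish for
   z i0 = 0 and z i0 = p, shifting z cyclically does the job. *)
pose f (z : {ffun 'I_N -> 'I_p}) : {ffun 'I_N -> 'I_p} :=
  [ffun i => if i == i0 then ordS (z i) else z i].
have f_inj : injective f.
  move=> z1 z2 /ffunP E; apply/ffunP => i; have := E i; rewrite !ffunE.
  by case: eqP => // _; apply: ordS_inj.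
rewrite sumrB [X in _ - X](reindex_inj f_inj) /= -sumrB big1 // => z _.
have si0 i : (s i == ord0) = (i == i0) by rewrite /i0 (canF_eq (permK s)).
have zE : z i0 = p' :> nat \/ (z i0 < p')%N.
  by have : (z i0 < p'.+1)%N := ltn_ord (z i0); rewrite ltnS leq_eqVlt => /orP[/eqP|]; [left|right].
case: zE => zE.
  rewrite !E0 ?subrr //; first by rewrite /nat_pt /f ffunE eqxx /= zE modnn.
  by rewrite si0 eqxx zE addn1 eqxx orbT.
suff -> : nat_pt (f z) = (fun i => z i + (s i == ord0))%N by rewrite subrr.
apply: funext => i; rewrite /nat_pt /f ffunE si0; case: eqP => [->|_]; rewrite ?addn0 //=.
by rewrite addn1 modn_small.
Qed.


(** * From labels to sign changes *)

Section FirstFalse.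
Implicit Types b : ('I_N -> nat) -> 'I_N -> bool.

(** When [b x] holds at every coordinate, [find] returns the length N, which serves as the extra
    label. *)
Definition first_false b (x : 'I_N -> nat) : 'I_N.+1 :=
  inord (find (fun i => ~~ b x i) (enum 'I_N)).

Let first_falseE b x : first_false b x = find (fun i => ~~ b x i) (enum 'I_N) :> nat.
Proof. by rewrite inordK // ltnS (leq_trans (find_size _ _)) // size_enum_ord. Qed.

Lemma before_first_false b x (i : 'I_N) : (i < first_false b x)%N -> b x i.
Proof. by rewrite first_falseE => /(before_find i)/negbFE; rewrite nth_ord_enum. Qed.

Lemma at_first_false b x (i : 'I_N) : first_false b x = i :> nat -> ~~ b x i.
Proof.
rewrite first_falseE => E.
have : has (fun i => ~~ b x i) (enum 'I_N) by rewrite has_find E size_enum_ord.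
by move/(nth_find i); rewrite E nth_ord_enum.
Qed.

Lemma label_inj_simplex lab z s (k1 k2 : 'I_N.+1) :
  \det (simplex_mx lab z s) != 0 ->
  lab (kuhn_vertex z s k1) = lab (kuhn_vertex z s k2) -> k1 = k2.
Proof.
move=> dN E; apply/eqP; apply: contraNT dN => kk; apply/eqP.
apply: (determinant_alternate kk) => j; rewrite !mxE; case: eqP => // _.
by rewrite E.
Qed.

(** Some simplex has nonzero determinant, hence all labels. The vertex labelled [i] makes [b] fail
    at [i]; the vertex labelled N makes it hold at every coordinate at once. *)
Lemma rainbow_simplex b : label_degree (first_false b) <> 0 ->
  exists (z : {ffun 'I_N -> 'I_p}) s, forall i : 'I_N, exists k1 k2 : nat,
    ~~ b (kuhn_vertex (nat_pt z) s k1) i /\ b (kuhn_vertex (nat_pt z) s k2) i.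
Proof.
move=> T0.
have [z [s dN]] : exists (z : {ffun 'I_N -> 'I_p}) s,
    \det (simplex_mx (first_false b) (nat_pt z) s) != 0.
  apply: contrapT => nex; apply: T0; apply: big1 => z _; apply: big1 => s _.
  have [->|/eqP dN] := eqVneq (\det (simplex_mx (first_false b) (nat_pt z) s)) 0.
    by rewrite mulr0.
  by case: nex; exists z, s; apply/eqP.
exists z, s => i.
pose f (k : 'I_N.+1) := first_false b (kuhn_vertex (nat_pt z) s k).
have f_inj : injective f by move=> k1 k2; apply: label_inj_simplex.
have [g _ gK] := injF_bij f_inj.
exists (g (widen_ord (leqnSn N) i)), (g ord_max); split.
  by apply: at_first_false; rewrite -/(f _) gK.
by apply: before_first_false; rewrite -/(f _) gK /=.
Qed.

Lemma incr_bounded_id (f : nat -> nat) n :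
  (forall k, (k < n)%N -> (f k < f k.+1)%N) -> (f n <= n)%N ->
  forall k, (k <= n)%N -> f k = k.
Proof.
elim: n => [|n IH] fI fn k; first by rewrite leqn0 => /eqP ->; apply/eqP; rewrite -leqn0.
have fnn : (f n <= n)%N by rewrite -ltnS (leq_trans (fI n _)).
have {}IH := IH (fun k kn => fI k (ltnW kn)) fnn.
rewrite leq_eqVlt => /orP[/eqP ->|]; last exact: IH.
by apply/eqP; rewrite eqn_leq fn -{1}(IH n) // fI.
Qed.

Let b0 (x : 'I_N -> nat) (i : 'I_N) : bool := (1 < x i)%N.

(** Coordinates only grow along a simplex, so the labels of a rainbow simplex increase and vertex
    [k] has label [k]. Comparing the vertices [i] and [i+1] at coordinate [i] forces [z i = 1] and
    [s i = i]: exactly one simplex counts. *)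
Lemma label_degree_id : (0 < p')%N -> label_degree (first_false b0) = 1.
Proof.
move=> p0.
have id_simplex z s : \det (simplex_mx (first_false b0) z s) != 0 ->
    (forall k, (k <= N)%N -> first_false b0 (kuhn_vertex z s k) = k :> nat).
  move=> dN; apply: incr_bounded_id; last by rewrite -ltnS.
  move=> k kN; rewrite ltn_neqAle; apply/andP; split.
    have k1 : (k < N.+1)%N by apply: ltnW.
    apply: contraTneq (ltnSn k) => /val_inj E.
    have := @label_inj_simplex _ _ _ (Ordinal k1) (Ordinal (kN : k.+1 < N.+1)%N) dN E.
    by move/(congr1 val)/n_Sn.
  rewrite leqNgt; apply/negP => lt.
  have iN : (first_false b0 (kuhn_vertex z s k.+1) < N)%N.
    by apply: leq_trans lt _; rewrite -ltnS.
  have := @before_first_false b0 _ (Ordinal iN) lt.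
  have := @at_first_false b0 _ (Ordinal iN) erefl.
  by rewrite /b0 /kuhn_vertex -leqNgt; lia.
have uniq_simplex z s : \det (simplex_mx (first_false b0) z s) != 0 ->
    (forall i, z i = 1%N) /\ s = 1%g.
  move=> /id_simplex E.
  have H (i : 'I_N) : z i = 1%N /\ s i = i :> nat.
    have := @at_first_false b0 _ i (E i (ltnW (ltn_ord i))).
    have : b0 (kuhn_vertex z s i.+1) i.
      by apply: before_first_false; rewrite E.
    by rewrite /b0 /kuhn_vertex; lia.
  split=> [i|]; first by have [] := H i.
  by apply/permP => i; apply: val_inj; rewrite perm1; have [] := H i.
pose z1 : {ffun 'I_N -> 'I_p} := [ffun => inord 1].
have z1E : nat_pt z1 = fun=> 1%N by apply: funext => i; rewrite /nat_pt ffunE inordK.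
rewrite /label_degree (bigD1 z1) //= (bigD1 1%g) //=.
rewrite [X in _ + X]big1 ?addr0; last first.
  move=> z zz; apply: big1 => s _.
  have [->|dN] := eqVneq (\det (simplex_mx (first_false b0) (nat_pt z) s)) 0.
    by rewrite mulr0.
  case/negP: zz; apply/eqP/ffunP => i; apply: val_inj.
  have [/(_ i) + _] := uniq_simplex _ _ dN; rewrite /nat_pt /= => zi.
  by rewrite [LHS]zi ffunE /= inordK.
rewrite [X in _ + X]big1 ?addr0; last first.
  move=> s ss; have [->|dN] := eqVneq (\det (simplex_mx (first_false b0) (nat_pt z1) s)) 0.
    by rewrite mulr0.
  by case/negP: ss; apply/eqP; have [] := uniq_simplex _ _ dN.
rewrite odd_perm1 expr0 mul1r z1E.
have labE (k : 'I_N.+1) : first_false b0 (kuhn_vertex (fun=> 1%N) 1%g k) = k.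
  apply: val_inj => /=.
  have lt (i : 'I_N) : b0 (kuhn_vertex (fun=> 1%N) 1%g k) i = (i < k)%N.
    by rewrite /b0 /kuhn_vertex perm1; lia.
  have [kN|Nk] := ltnP k (first_false b0 (kuhn_vertex (fun=> 1%N) 1%g k)).
    have k1 : (k < N)%N by apply: leq_trans kN _; rewrite -ltnS.
    by have := before_first_false (i := Ordinal k1) kN; rewrite lt ltnn.
  apply/eqP; rewrite eqn_leq Nk /= leqNgt; apply/negP => lk.
  have k1 : (first_false b0 (kuhn_vertex (fun=> 1%N) 1%g k) < N)%N.
    by apply: leq_trans lk _; rewrite -ltnS.
  by have := at_first_false (i := Ordinal k1) erefl; rewrite lt lk.
rewrite -det_tr det_trig; last first.
  apply/is_trig_mxP => i j ij; rewrite !mxE labE.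
  have -> : (i == ord_max) = false.
    by apply/negbTE; rewrite -val_eqE /=; have := ltn_ord j; lia.
  by rewrite -val_eqE /= gtn_eqF.
by apply: big1 => i _; rewrite !mxE labE; case: eqP => //; rewrite eqxx.
Qed.

(** On the boundary [b] is replaced by the model [b0], which makes the degree 1. A simplex touching
    a face stays within the two outermost layers there, where [b] and [b0] agree and have a constant
    value at that coordinate; so the rainbow simplex avoids the boundary. *)
Theorem discrete_zero b : (2 < p)%N ->
  (forall x i, (x i <= 1)%N -> ~~ b x i) ->
  (forall x i, (p' <= x i)%N -> b x i) ->
  exists (z : {ffun 'I_N -> 'I_p}) s, forall i : 'I_N, exists k1 k2 : nat,
    ~~ b (kuhn_vertex (nat_pt z) s k1) i /\ b (kuhn_vertex (nat_pt z) s k2) i.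
Proof.
move=> p2 bl bh.
pose B x i := if on_boundary x then b0 x i else b x i.
have [|z [s H]] := @rainbow_simplex B.
  have p0 : (0 < p')%N by rewrite -ltnS ltnW.
  rewrite (@label_degree_boundary (first_false B) (first_false b0)).
    by rewrite label_degree_id.
  by move=> x xb; apply: val_inj; rewrite /= !first_falseE /B xb.
exists z, s.
have nb k : on_boundary (kuhn_vertex (nat_pt z) s k) = false.
  apply/negbTE/negP => /existsP[i kb]; have [k1 [k2]] := H i; rewrite /B.
  have zp := ltn_ord (z i).
  have Hl k' : (kuhn_vertex (nat_pt z) s k i == 0%N) -> ~~ B (kuhn_vertex (nat_pt z) s k') i.
    move=> k0; have k'1 : (kuhn_vertex (nat_pt z) s k' i <= 1)%N.
      by move: k0; rewrite /kuhn_vertex; lia.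
    by rewrite /B; case: ifP => _; rewrite ?bl // /b0 -leqNgt.
  have Hh k' : (kuhn_vertex (nat_pt z) s k i == p) -> B (kuhn_vertex (nat_pt z) s k') i.
    move=> k0; have k'1 : (p' <= kuhn_vertex (nat_pt z) s k' i)%N.
      by move: k0; rewrite /kuhn_vertex /p; lia.
    rewrite /B; case: ifP => _; rewrite ?bh // /b0; move: p2 k'1; rewrite /p; lia.
  rewrite -!/(B _ _) => -[B1 B2].
  by case/orP: kb => kb; [have := Hl k2 kb; rewrite B2|move: B1; rewrite (Hh k1 kb)].
move=> i; have [k1 [k2]] := H i; rewrite /B !nb => ?; by exists k1, k2.
Qed.

End FirstFalse.
End Sperner.

(** * Zeros of maps at bounded distance from the identity *)

(* On a matrix space [nbhs] unfolds to an explicit filter on which [cvgD] and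
   friends fail to find their [Filter] instance; stating the continuity rules
   over an abstract domain avoids this. *)
Section ContinuityRules.
Variables (R : realType) (T : topologicalType).

Lemma continuous_compose (U V : topologicalType) (f : T -> U) (g : U -> V) :
  continuous f -> continuous g -> continuous (fun x => g (f x)).
Proof. by move=> cf cg x; apply: continuous_comp; [exact: cf|exact: cg]. Qed.

Lemma continuous_add (V : normedModType R) (f g : T -> V) :
  continuous f -> continuous g -> continuous (fun x => f x + g x).
Proof. by move=> cf cg x; apply: cvgD; [exact: cf|exact: cg]. Qed.

Lemma continuous_opp (V : normedModType R) (f : T -> V) :
  continuous f -> continuous (fun x => - f x).
Proof. by move=> cf x; apply: cvgN; exact: cf. Qed.

Lemma continuous_sub (V : normedModType R) (f g : T -> V) :
  continuous f -> continuous g -> continuous (fun x => f x - g x).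
Proof. by move=> cf cg; apply: continuous_add => //; exact: continuous_opp. Qed.

Lemma continuous_scale (V : normedModType R) (f : T -> R) (g : T -> V) :
  continuous f -> continuous g -> continuous (fun x => f x *: g x).
Proof. by move=> cf cg x; apply: cvgZ; [exact: cf|exact: cg]. Qed.

Lemma continuous_mul (f g : T -> R) :
  continuous f -> continuous g -> continuous (fun x => f x * g x).
Proof. by move=> cf cg x; apply: cvgM; [exact: cf|exact: cg]. Qed.

Lemma continuous_inv (f : T -> R) : (forall x, f x != 0) ->
  continuous f -> continuous (fun x => (f x)^-1).
Proof. by move=> f0 cf x; apply: cvgV => //; exact: cf. Qed.

Lemma continuous_pair (U V : topologicalType) (f : T -> U) (g : T -> V) :
  continuous f -> continuous g -> continuous (fun x => (f x, g x)).
Proof. by move=> cf cg x; apply: cvg_pair; [exact: cf|exact: cg]. Qed.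

Lemma continuous_id : continuous (fun x : T => x).
Proof. by move=> x; exact: cvg_id. Qed.

End ContinuityRules.

Section MatrixTopology.
Variable R : realType.

Lemma mx_norm_leP m n (A : 'M[R]_(m, n)) (e : R) :
  0 <= e -> `|A| <= e <-> (forall i j, `|A i j| <= e).
Proof.
move=> e0; split=> [Ae i j|H].
  by apply: le_trans Ae; rewrite {2}/normr /= mx_normrE; apply/bigmax_geP; right; exists (i, j).
by rewrite /normr /= mx_normrE; apply/bigmax_leP; split => //= -[i j] _ /=.
Qed.

Lemma entry_le_norm m n (A : 'M[R]_(m, n)) i j : `|A i j| <= `|A|.
Proof. exact: (mx_norm_leP A (normr_ge0 A)).1. Qed.

Lemma continuous_mxP (T : topologicalType) m n (f : T -> 'M[R]_(m, n)) :
  continuous f <-> (forall i j, continuous (fun x => f x i j)).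
Proof.
split=> [cf i j x|cf x].
  apply: (@continuous_comp _ _ _ f (fun M : 'M[R]_(m, n) => M i j)).
    exact: cf.
  exact: coord_continuous.
apply/cvgrPdist_le => e e0.
have H : \forall y \near x, forall ij : 'I_m * 'I_n, `|f x ij.1 ij.2 - f y ij.1 ij.2| <= e.
  apply: filter_forall => -[i j] /=.
  by have /cvgrPdist_le := cf i j x; apply.
apply: filterS H => y H; apply/mx_norm_leP; first exact: ltW.
by move=> i j; rewrite !mxE; exact: (H (i, j)).
Qed.

Lemma continuous_sumr (T : topologicalType) (I : Type) (r : seq I) (P : pred I) (F : I -> T -> R) :
  (forall i, P i -> continuous (F i)) -> continuous (fun x => \sum_(i <- r | P i) F i x).
Proof. by apply: continuous_big; exact: (@add_continuous R^o). Qed.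

Lemma continuous_prodr (T : topologicalType) (I : Type) (r : seq I) (P : pred I) (F : I -> T -> R) :
  (forall i, P i -> continuous (F i)) -> continuous (fun x => \prod_(i <- r | P i) F i x).
Proof. by apply: continuous_big; exact: mul_continuous. Qed.

Lemma continuous_mulmx (T : topologicalType) m n p (f : T -> 'M[R]_(m, n)) (g : T -> 'M[R]_(n, p)) :
  continuous f -> continuous g -> continuous (fun x => f x *m g x).
Proof.
move=> /continuous_mxP cf /continuous_mxP cg; apply/continuous_mxP => i j.
under eq_fun do rewrite mxE.
apply: continuous_sumr => k _ x; apply: cvgM; [exact: cf|exact: cg].
Qed.

Lemma continuous_trmx (T : topologicalType) m n (f : T -> 'M[R]_(m, n)) :
  continuous f -> continuous (fun x => (f x)^T).
Proof.
move=> /continuous_mxP cf; apply/continuous_mxP => i j.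
by under eq_fun do rewrite mxE; exact: cf.
Qed.

Lemma continuous_det (T : topologicalType) n (f : T -> 'M[R]_n) :
  continuous f -> continuous (fun x => \det (f x)).
Proof.
move=> /continuous_mxP cf; apply: continuous_sumr => s _ x.
by apply: cvgM; [exact: cvg_cst|apply: continuous_prodr => i _; exact: cf].
Qed.

End MatrixTopology.

Section Zero.
Variables (R : realType) (N : nat).
Implicit Type x : 'rV[R]_N.

Lemma approx_zero (f : 'rV[R]_N -> 'rV[R]_N) (B : R) : 
  (forall x, `|f x - x| <= B) -> forall e : R, 0 < e ->
  exists x, `|x| <= B + 1 /\ forall i : 'I_N, exists a b : 'rV[R]_N,
    [/\ `|a - x| <= e, `|b - x| <= e, f a ord0 i < 0 & 0 <= f b ord0 i].
Proof.
case: N f => [|N'] f fB e e0.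
  by exists 0; rewrite normr0; split=> [|[]//]; rewrite addr_ge0 // (le_trans _ (fB 0)).
have B0 : 0 <= B by apply: le_trans (fB 0).
(* The margin 1 exceeds the mesh [st], so on the two outermost grid layers at either end of a
   coordinate the bound [B] fixes the sign of that coordinate of [f]. *)
pose C := B + 1.
have C0 : 0 < C by rewrite /C; lra.
pose q := (truncn (2 * C / Num.min e 1)).+2.
pose p := q.+1.
have p0 : 0 < p%:R :> R by rewrite ltr0n.
pose st := 2 * C / p%:R.
have st0 : 0 < st by rewrite divr_gt0 // mulr_gt0.
have m0 : 0 < Num.min e 1 by rewrite lt_min e0 ltr01.
have stm : st < Num.min e 1.
  rewrite /st ltr_pdivrMr // -ltr_pdivrMl // mulrC.
  have /andP[_ lt] := truncn_itv (ltW (divr_gt0 (mulr_gt0 (ltr0n _ 2) C0) m0)).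
  by apply: lt_le_trans lt _; rewrite ler_nat !ltnS ltnW.
have ste : st <= e by move: stm; rewrite lt_min => /andP[/ltW].
have st1 : st < 1 by move: stm; rewrite lt_min => /andP[].
pose pt (k : 'I_N'.+1 -> nat) : 'rV[R]_N'.+1 := \row_i (- C + (k i)%:R * st).
pose b k i := 0 <= f (pt k) ord0 i.
have fE k i : `|f (pt k) ord0 i - (- C + (k i)%:R * st)| <= B.
  by have := le_trans (entry_le_norm _ ord0 i) (fB (pt k)); rewrite !mxE.
have pst : p%:R * st = 2 * C by rewrite /st mulrC divfK // gt_eqF.
have [|||z [s H]] := @discrete_zero N' q b; first by [].
- move=> k i ki; rewrite /b -ltNge; have := fE k i.
  have : (k i)%:R * st <= st by rewrite -[leRHS]mul1r ler_pM2r // -[1]/(1%:R) ler_nat.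
  by rewrite /C ler_norml => ? /andP[? ?]; lra.
- move=> k i ki; rewrite /b; have := fE k i.
  have : (p%:R - 1) * st <= (k i)%:R * st.
    by rewrite ler_pM2r // /p -natr1 addrK ler_nat.
  by rewrite mulrBl pst mul1r /C ler_norml => ? /andP[? ?]; lra.
exists (pt (nat_pt z)); split.
  apply/mx_norm_leP; first exact: ltW.
  move=> i j; rewrite ord1 mxE ler_norml.
  have : (nat_pt z j)%:R * st <= 2 * C.
    by rewrite -pst ler_pM2r // ler_nat; apply: ltnW; exact: ltn_ord.
  have : 0 <= (nat_pt z j)%:R * st by rewrite mulr_ge0 // ltW.
  by rewrite /C; lra.
have close k : `|pt (kuhn_vertex (nat_pt z) s k) - pt (nat_pt z)| <= e.
  apply/mx_norm_leP; first exact: ltW.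
  move=> i j; rewrite !mxE /kuhn_vertex natrD ler_norml.
  have : 0 <= (s j < k)%N%:R * st <= st.
    by case: (_ < _)%N; rewrite ?mul1r ?mul0r ?lexx ltW.
  by rewrite mulrDl; lra.
move=> i; have [k1 [k2 [b1 b2]]] := H i.
exists (pt (kuhn_vertex (nat_pt z) s k1)), (pt (kuhn_vertex (nat_pt z) s k2)).
by split=> //; rewrite ltNge.
Qed.

Lemma compact_row_ball (c : R) : compact [set x : 'rV[R]_N | `|x| <= c].
Proof.
apply: bounded_closed_compact.
  by exists c; split; [exact: num_real|move=> y cy x /= xc; exact: le_trans (ltW cy)].
apply: (@closed_comp _ _ (fun x : 'rV[R]_N => `|x|) [set r | r <= c]); last exact: closed_le.
by move=> x _; exact: norm_continuous.
Qed.

Theorem bounded_displacement_zero (f : 'rV[R]_N -> 'rV[R]_N) (B : R) : 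
  continuous f -> (forall x, `|f x - x| <= B) -> exists x, f x = 0.
Proof.
move=> fc fB.
pose A (e : R) := [set x : 'rV[R]_N | `|x| <= B + 1 /\ forall i : 'I_N, exists a b : 'rV[R]_N,
    [/\ `|a - x| <= e, `|b - x| <= e, f a ord0 i < 0 & 0 <= f b ord0 i]].
pose F := filter_from [set e : R | 0 < e] A.
have FF : ProperFilter F.
  apply: filter_from_proper; last by move=> e e0; exact: approx_zero.
  apply: filter_from_filter; first by exists 1 => /=.
  move=> e1 e2 /= e10 e20; exists (Num.min e1 e2); first by rewrite /= lt_min e10.
  move=> x [xB H]; split; split=> // i; have [a [b [ax bx fa fb]]] := H i; exists a, b; split=> //.
  - by apply: le_trans ax _; rewrite ge_min lexx.
  - by apply: le_trans bx _; rewrite ge_min lexx.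
  - by apply: le_trans ax _; rewrite ge_min lexx orbT.
  - by apply: le_trans bx _; rewrite ge_min lexx orbT.
(* Every neighbourhood of a cluster point of the sets [A e] contains, for each coordinate, points
   where that coordinate of [f] is negative and points where it is not. *)
have [|x [xB clx]] := @compact_row_ball (B + 1) F FF.
  by exists 1 => //= x [].
exists x; apply/rowP => i; rewrite mxE; apply: contrapT => /eqP fx0.
have cfi := (continuous_mxP f).1 fc ord0 i x.
have /cvgrPdist_lt/(_ `|f x ord0 i|) := cfi.
rewrite normr_gt0 fx0 => /(_ isT) /nbhs_ballP[r /= r0 rH].
have r20 : 0 < r / 2 by rewrite divr_gt0.
have [||y [[yB Hy] yx]] := clx (A (r / 3)) (ball x (r / 2)).
- by exists (r / 3) => //=; rewrite divr_gt0.
- exact: nbhsx_ballx.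
have [a [b [ay by_ fa fb]]] := Hy i.
have inball c : `|c - y| <= r / 3 -> ball x r c.
  move=> cy; rewrite -ball_normE /=; move: yx; rewrite -ball_normE /= => yx.
  have -> : x - c = (x - y) - (c - y) by rewrite opprB addrA subrK.
  by apply: le_lt_trans (ler_normB _ _) _; lra.
have := rH _ (inball _ ay); have := rH _ (inball _ by_).
rewrite /= => Hb Ha.
have {fx0} [fx0|fx0] : 0 < f x ord0 i \/ f x ord0 i < 0.
  by move: fx0; rewrite neq_lt => /orP[]; [right|left].
- by move: Ha; rewrite (gtr0_norm fx0) ltr_norml => /andP[]; lra.
- by move: Hb; rewrite (ltr0_norm fx0) ltr_norml => /andP[]; lra.
Qed.

End Zero.

(** * Invariance of dimension *)

Lemma lipschitz_continuous (R : realType) (V W : normedModType R) (f : V -> W) (L : R) :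
  0 < L -> (forall x y, `|f x - f y| <= L * `|x - y|) -> continuous f.
Proof.
move=> L0 fL x; apply/cvgrPdist_le => e e0.
have eL0 : 0 < e / L by rewrite divr_gt0.
have : nbhs x (ball x (e / L)) by exact: nbhsx_ballx.
apply: filterS => y; rewrite -ball_normE /= => /ltW xy; apply: le_trans (fL _ _) _.
by rewrite mulrC -ler_pdivlMr.
Qed.

Section Clamp.
Variables (R : realType) (n : nat) (c : R).
Hypothesis c0 : 0 < c.

(** The norm of a row is its maximum norm, so truncating each coordinate retracts onto the ball of
    radius [c]. *)
Definition clamp (x : 'rV[R]_n) : 'rV[R]_n := \row_j Num.max (- c) (Num.min c (x ord0 j)).

Lemma clamp_continuous : continuous clamp.
Proof.
apply/continuous_mxP => i j; under eq_fun do rewrite mxE.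
move=> x.
apply: (@continuous_max R _ (fun=> - c) (fun y : 'rV[R]_n => Num.min c (y ord0 j)) x).
  exact: cst_continuous.
apply: (@continuous_min R _ (fun=> c) (fun y : 'rV[R]_n => y ord0 j) x).
  exact: cst_continuous.
exact: coord_continuous.
Qed.

Lemma clamp_le x : `|clamp x| <= c.
Proof.
apply/mx_norm_leP => [|i j]; first exact: ltW.
by rewrite mxE ler_norml le_max lexx /= ge_max ge_min lexx /= andbT ge0_cp // ltW.
Qed.

Lemma clamp_id x : `|x| <= c -> clamp x = x.
Proof.
move=> xc; apply/rowP => j; rewrite mxE.
have := le_trans (entry_le_norm x ord0 j) xc; rewrite ler_norml => /andP[? ?].
by rewrite min_r // max_r.
Qed.

End Clamp.

(** Since [C p + 1 <= (C+1) p], the left side is at most [(C+1)^n p^n], and [p] was chosen to exceed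
    [(C+1)^n]. *)
Lemma pigeonhole_grid (n C p : nat) : p = (C.+1 ^ n).+1 ->
  (((C * p).+1) ^ n < p ^ n.+1)%N.
Proof.
move=> pE; have p0 : (0 < p)%N by rewrite pE.
apply: (@leq_ltn_trans ((C.+1 * p) ^ n)).
  case: n pE => [|n] pE; first by rewrite !expn0.
  by rewrite leq_exp2r // mulSn -[leqLHS]add1n leq_add2r.
by rewrite expnMn expnS ltn_pmul2r ?expn_gt0 ?p0 // pE.
Qed.

Lemma natr_dist_lt1 (R : realType) (a b : nat) : `|a%:R - b%:R : R| < 1 -> a = b.
Proof.
wlog ab : a b / (a <= b)%N.
  move=> H; case/orP: (leq_total a b) => ab; first exact: H.
  by rewrite distrC => /(H _ _ ab).
rewrite distrC -natrB // normr_nat -[1]/(1%:R) ltr_nat ltnS leqn0 subn_eq0 => ba.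
by apply/eqP; rewrite eqn_leq ab.
Qed.

Section Dimension.
Variables (R : realType) (N : nat).

(** On the compact set of pairs at distance at least [e], the distance of the images attains a
    minimum, positive by injectivity. *)
Lemma uniform_injectivity m (F : 'rV[R]_m -> 'rV[R]_N) (c : R) : continuous F ->
  (forall x y, `|x| <= c -> `|y| <= c -> F x = F y -> x = y) ->
  forall e, 0 < e -> exists2 d, 0 < d &
    forall x y, `|x| <= c -> `|y| <= c -> `|F x - F y| < d -> `|x - y| <= e.
Proof.
move=> Fc Fi e e0.
pose D := [set x : 'rV[R]_m | `|x| <= c].
pose S := (D `*` D) `&` [set z : 'rV[R]_m * 'rV[R]_m | e <= `|z.1 - z.2|].
have dc : continuous (fun z : 'rV[R]_m * 'rV[R]_m => `|z.1 - z.2|).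
  by move=> z; apply: cvg_norm; apply: cvgB; [exact: cvg_fst|exact: cvg_snd].
have cS : compact S.
  apply: compact_closedI; first by apply: compact_setX; exact: compact_row_ball.
  apply: (@preimage_closed _ _ (fun z : 'rV[R]_m * 'rV[R]_m => `|z.1 - z.2|) [set r | e <= r]).
    by move=> z _; exact: dc.
  exact: closed_ge.
have [S0|nS0] := pselect (S !=set0); last first.
  exists 1 => // x y xc yc _; rewrite leNgt; apply/negP => exy; apply: nS0.
  by exists (x, y); split => //=; exact: ltW.
have hc : continuous (fun z : 'rV[R]_m * 'rV[R]_m => `|F z.1 - F z.2|).
  move=> z; apply: cvg_norm; apply: cvgB.
    by apply: (@cvg_comp _ _ _ fst F); [exact: cvg_fst|exact: Fc].
  by apply: (@cvg_comp _ _ _ snd F); [exact: cvg_snd|exact: Fc].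
have [|[a b] + ab] := compact_EVT_min S0 cS
    (f := (fun z : 'rV[R]_m * 'rV[R]_m => `|F z.1 - F z.2|)).
  exact: continuous_subspaceT.
rewrite inE => -[[/= ac bc] eab].
exists `|F a - F b|.
  rewrite normr_gt0 subr_eq0; apply/eqP => /Fi E; move: eab.
  by rewrite E // subrr normr0 leNgt e0.
move=> x y xc yc; apply: contraTT; rewrite -ltNge -leNgt => /ltW exy.
by apply: (ab (x, y)); rewrite inE.
Qed.

Section LipschitzInverse.
Variables (m : nat) (F : 'rV[R]_m -> 'rV[R]_N) (c L : R).
Hypotheses (c0 : 0 < c) (L0 : 0 < L).

(* Lipschitz sup-convolution; evaluated at F x it is close to coordinate j of x. *)
Definition sup_conv (j : 'I_m) (z : 'rV[R]_N) : R :=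
  sup ((fun x : 'rV[R]_m => x ord0 j - L * `|z - F x|) @` [set x | `|x| <= c]).

Lemma sup_conv_ub j z (x : 'rV[R]_m) : `|x| <= c -> x ord0 j - L * `|z - F x| <= sup_conv j z.
Proof.
move=> xc; apply: ub_le_sup; last by exists x.
exists c => _ [y yc <-].
have := le_trans (entry_le_norm y ord0 j) yc; rewrite ler_norml => /andP[_].
by apply: le_trans; rewrite gerBl mulr_ge0 // ltW.
Qed.

Lemma sup_conv_le j z b :
  (forall x : 'rV[R]_m, `|x| <= c -> x ord0 j - L * `|z - F x| <= b) -> sup_conv j z <= b.
Proof.
move=> H; apply: ge_sup; last by move=> _ [x xc <-]; exact: H.
by exists (0 - L * `|z - F 0|); exists 0; rewrite ?mxE //= normr0 ltW.
Qed.

Lemma sup_conv_lip j z z' : `|sup_conv j z - sup_conv j z'| <= L * `|z - z'|.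
Proof.
have H u u' : sup_conv j u - sup_conv j u' <= L * `|u - u'|.
  rewrite lerBlDl; apply: sup_conv_le => x xc.
  have := sup_conv_ub j u' xc.
  have : L * `|u' - F x| <= L * `|u - u'| + L * `|u - F x|.
    rewrite -mulrDr ler_pM2l // (distrC u).
    by have := ler_distD u u' (F x).
  by lra.
by rewrite ler_norml H andbT lerNl opprB (distrC z).
Qed.

Definition approx_inv (z : 'rV[R]_N) : 'rV[R]_m := \row_j sup_conv j z.

Lemma approx_inv_lip z z' : `|approx_inv z - approx_inv z'| <= L * `|z - z'|.
Proof.
apply/mx_norm_leP => [|i j]; first by rewrite mulr_ge0 // ltW.
by rewrite !mxE; exact: sup_conv_lip.
Qed.

(** In the supremum at [F x], the competitor [x] gives the lower bound. A competitor [y] with [F y]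
    within [d] of [F x] is itself [e]-close to [x]; any other pays a penalty of at least
    [L d >= 2 c], the width of the ball. *)
Lemma approx_invP e d : 0 < e -> c *+ 2 <= L * d ->
  (forall x y, `|x| <= c -> `|y| <= c -> `|F x - F y| < d -> `|x - y| <= e) ->
  forall x, `|x| <= c -> `|approx_inv (F x) - x| <= e.
Proof.
move=> e0 cLd H x xc; apply/mx_norm_leP => [|i j]; first exact: ltW.
rewrite ord1 !mxE ler_norml.
have := sup_conv_ub j (F x) xc; rewrite subrr normr0 mulr0 subr0 => lo.
suff : sup_conv j (F x) <= x ord0 j + e by lra.
apply: sup_conv_le => y yc.
have [lt|ge] := ltP `|F x - F y| d.
  have := le_trans (entry_le_norm _ ord0 j) (H _ _ xc yc lt).
  have : 0 <= L * `|F x - F y| by rewrite mulr_ge0 // ltW.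
  by rewrite !mxE ler_norml; lra.
have := le_trans (entry_le_norm x ord0 j) xc.
have := le_trans (entry_le_norm y ord0 j) yc.
have : L * d <= L * `|F x - F y| by rewrite ler_pM2l.
by rewrite !ler_norml; lra.
Qed.

End LipschitzInverse.

(** Take preimages of [p^(N+1)] grid points of spacing [r / p]. The cube of radius [A] has too few
    cells of side [2 A / (C p)], so two preimages share one; as [C r > 2 A L], their images are less
    than [r / p] apart. *)
Lemma lipschitz_image_misses (L A r : R) (D : set 'rV[R]_N) (G : 'rV[R]_N -> 'rV[R]_N.+1) :
  0 < L -> 0 < A -> 0 < r -> (forall z, D z -> `|z| <= A) ->
  (forall z z', `|G z - G z'| <= L * `|z - z'|) ->
  ~ (forall y, `|y| <= r -> exists2 z, D z & G z = y).
Proof.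
move=> L0 A0 r0 DA GL onto.
pose C := (truncn (2 * A * L / r)).+1.
have CH : 2 * A * L < C%:R * r.
  rewrite -ltr_pdivrMr //.
  by have /andP[_] := truncn_itv (ltW (divr_gt0 (mulr_gt0 (mulr_gt0 (ltr0n _ 2) A0) L0) r0)).
pose p := (C.+1 ^ N).+1.
pose q := (C * p)%N.
have p0 : 0 < p%:R :> R by rewrite ltr0n.
have q0 : 0 < q%:R :> R by rewrite ltr0n muln_gt0.
pose y (k : {ffun 'I_N.+1 -> 'I_p}) : 'rV[R]_N.+1 := \row_j (r * (k j)%:R / p%:R).
have yr k : `|y k| <= r.
  apply/mx_norm_leP => [|i j]; first exact: ltW.
  rewrite mxE ger0_norm; last by rewrite divr_ge0 ?mulr_ge0 // ltW.
  by rewrite ler_pdivrMr // ler_pM2l // ler_nat ltnW.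
have /choice[z zP] : forall k, exists w, D w /\ G w = y k.
  by move=> k; have [w ? ?] := onto _ (yr k); exists w.
pose t k j : R := (z k ord0 j + A) * q%:R / (2 * A).
have t0 k j : 0 <= t k j.
  have := le_trans (entry_le_norm (z k) ord0 j) (DA _ (zP k).1); rewrite ler_norml => /andP[lo _].
  by rewrite /t divr_ge0 ?mulr_ge0 //; lra.
have tq k j : t k j <= q%:R.
  have := le_trans (entry_le_norm (z k) ord0 j) (DA _ (zP k).1); rewrite ler_norml => /andP[_ hi].
  rewrite /t ler_pdivrMr; last by lra.
  by rewrite mulrC ler_pM2l //; lra.
pose cell (k : {ffun 'I_N.+1 -> 'I_p}) : {ffun 'I_N -> 'I_q.+1} :=
  [ffun j => inord (truncn (t k j))].
have cell_inj : injective cell.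
  move=> k k' /ffunP E.
  have zz : `|z k - z k'| <= 2 * A / q%:R.
    apply/mx_norm_leP => [|i j]; first by rewrite divr_ge0 // mulr_ge0 // ltW.
    have tl u : (truncn (t u j) < q.+1)%N.
      have /andP[h _] := truncn_itv (t0 u j).
      by rewrite ltnS -(ler_nat R); apply: le_trans h (tq _ _).
    have {}E : truncn (t k j) = truncn (t k' j).
      by have := congr1 val (E j); rewrite !ffunE /= !inordK.
    have /andP[h1 h2] := truncn_itv (t0 k j).
    have /andP[h3 h4] := truncn_itv (t0 k' j).
    have : `|t k j - t k' j| <= 1.
      by rewrite E -natr1 in h1 h2; rewrite -natr1 in h4; rewrite ler_norml; lra.
    have Aq : 0 <= 2 * A / q%:R by rewrite divr_ge0 ?mulr_ge0 // ltW.
    have -> : (z k - z k') i j = (t k j - t k' j) * (2 * A / q%:R).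
      by rewrite ord1 !mxE /t; field; rewrite !gt_eqF.
    by move=> tt; rewrite normrM (ger0_norm Aq) ler_piMl.
  have yy : `|y k - y k'| < r / p%:R.
    rewrite -(zP k).2 -(zP k').2; apply: le_lt_trans (GL _ _) _.
    apply: (@le_lt_trans _ _ (L * (2 * A / q%:R))); first by rewrite ler_pM2l.
    rewrite /q natrM invfM !mulrA ltr_pM2r ?invr_gt0 // ltr_pdivrMr ?ltr0n //.
    by rewrite mulrC [r * _]mulrC; move: CH; lra.
  apply/ffunP => j; apply: val_inj; apply: natr_dist_lt1.
  have := le_lt_trans (entry_le_norm _ ord0 j) yy; rewrite !mxE -mulrBl -mulrBr.
  rewrite normrM (gtr0_norm (_ : 0 < p%:R^-1)) ?invr_gt0 // ltr_pM2r ?invr_gt0 //.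
  by rewrite normrM gtr0_norm // gtr_pMr //; apply.
have := leq_card cell cell_inj; rewrite !card_ffun !card_ord leqNgt.
by rewrite pigeonhole_grid.
Qed.

(** With [G] the approximate left inverse, [G (F x)] is within [c / 2] of [x] on the ball. Extended
    past the ball by [clamp], this map has bounded displacement, so [G] sends the image of the ball
    onto the ball of radius [c / 2]; its Lipschitz bound forbids this. *)
Theorem no_injection (F : 'rV[R]_N.+1 -> 'rV[R]_N) (x0 : 'rV[R]_N.+1) (c : R) :
  0 < c -> continuous F ->
  ~ (forall x y, `|x - x0| <= c -> `|y - x0| <= c -> F x = F y -> x = y).
Proof.
wlog -> : F x0 / x0 = 0.
  move=> H c0 Fc Fi; apply: (H (fun x => F (x + x0)) 0 erefl c0).
    apply: (@continuous_compose _ _ _ _ F) => //.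
    by apply: continuous_add; [exact: continuous_id|exact: cst_continuous].
  move=> x y; rewrite !subr0 => xc yc E; apply: (addIr x0); apply: Fi => //; by rewrite addrK.
move=> c0 Fc Fi0.
have Fi x y : `|x| <= c -> `|y| <= c -> F x = F y -> x = y.
  by move=> xc yc; apply: Fi0; rewrite subr0.
have c20 : 0 < c / 2 by rewrite divr_gt0.
have [d d0 dP] := uniform_injectivity Fc Fi c20.
pose L := c *+ 2 / d.
have L0 : 0 < L by rewrite divr_gt0 // mulrn_wgt0.
have Ld : c *+ 2 <= L * d by rewrite divfK // gt_eqF.
pose G := approx_inv F c L.
have GL z z' : `|G z - G z'| <= L * `|z - z'| by exact: approx_inv_lip.
have GF x : `|x| <= c -> `|G (F x) - x| <= c / 2 by apply: approx_invP dP _.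
have [M M0 MP] : exists2 M, 0 < M & forall x, `|x| <= c -> `|F x| <= M.
  have [|M [_ MP]] := @compact_bounded R 'rV[R]_N (F @` [set x | `|x| <= c]).
    by apply: continuous_compact; [exact: continuous_subspaceT|exact: compact_row_ball].
  exists (`|M| + 1); first by rewrite ltr_wpDl.
  move=> x xc; apply: MP; last by exists x.
  by apply: le_lt_trans (ler_norm _) _; rewrite ltrDl.
apply: (@lipschitz_image_misses L M (c / 2) (F @` [set x | `|x| <= c]) G) => //.
  by move=> _ [x xc <-]; exact: MP.
move=> y yc.
have Gc : continuous G by exact: lipschitz_continuous GL.
have := @bounded_displacement_zero R N.+1 (fun x => G (F (clamp c x)) + (x - clamp c x) - y) c.
case.
- have cl := @clamp_continuous R N.+1 c.
  apply: continuous_sub; last exact: cst_continuous.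
  apply: continuous_add; last by apply: continuous_sub; [exact: continuous_id|exact: cl].
  apply: (@continuous_compose _ _ _ _ G) => //.
  exact: (@continuous_compose _ _ _ _ F).
- move=> x; have := GF _ (clamp_le c0 x).
  have -> : G (F (clamp c x)) + (x - clamp c x) - y - x = (G (F (clamp c x)) - clamp c x) - y.
    by move: (G (F (clamp c x))) (clamp c x) => a b; apply/rowP => j; rewrite !mxE; ring.
  by move=> h; apply: le_trans (ler_normB _ _) _; lra.
move=> x xE.
have hc := GF _ (clamp_le c0 x).
have {}xE : G (F (clamp c x)) - clamp c x = y - x.
  move: xE; move: (G (F (clamp c x))) (clamp c x) => a b /rowP xE; apply/rowP => j; have := xE j.
  by rewrite !mxE => h; apply/eqP; rewrite -subr_eq0 -h; apply/eqP; ring.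
have xc : `|x| <= c.
  have -> : x = y - (y - x) by rewrite opprB addrC subrK.
  by rewrite -xE; apply: le_trans (ler_normB _ _) _; lra.
exists (F x); first by exists x.
by move: xE; rewrite clamp_id // => /addIr.
Qed.

End Dimension.

(** * Gram matrices *)

Section Orthogonal.
Variable R : realType.

Definition dot d (u v : 'rV[R]_d) : R := (u *m v^T) ord0 ord0.

Lemma dotE d (u v : 'rV[R]_d) : dot u v = \sum_j u ord0 j * v ord0 j.
Proof. by rewrite /dot mxE; apply: eq_bigr => j _; rewrite mxE. Qed.

Lemma dotC d (u v : 'rV[R]_d) : dot u v = dot v u.
Proof. by rewrite !dotE; apply: eq_bigr => j _; rewrite mulrC. Qed.

Lemma dotBr d (u v w : 'rV[R]_d) : dot u (v - w) = dot u v - dot u w.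
Proof. by rewrite /dot linearB mulmxBr !mxE. Qed.

Lemma dotBl d (u v w : 'rV[R]_d) : dot (u - v) w = dot u w - dot v w.
Proof. by rewrite ![dot _ w]dotC dotBr. Qed.

Lemma dot_ge0 d (u : 'rV[R]_d) : 0 <= dot u u.
Proof. by rewrite dotE; apply: sumr_ge0 => j _; rewrite -expr2 sqr_ge0. Qed.

Lemma dot_eq0 d (u : 'rV[R]_d) : dot u u = 0 -> u = 0.
Proof.
rewrite dotE => /eqP; rewrite psumr_eq0 => [/allP u0|j _]; last by rewrite -expr2 sqr_ge0.
apply/rowP => j; rewrite mxE; apply/eqP.
by have := u0 j (mem_index_enum _); rewrite mulf_eq0 orbb.
Qed.

Lemma gramE m d (P : 'M[R]_(m, d)) i j : (P *m P^T) i j = dot (row i P) (row j P).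
Proof. by rewrite dotE !mxE; apply: eq_bigr => k _; rewrite !mxE. Qed.

Definition householder d (v : 'rV[R]_d) : 'M[R]_d :=
  1%:M - (2 / dot v v) *: (v^T *m v).

Lemma householder_tr d (v : 'rV[R]_d) : (householder v)^T = householder v.
Proof. by rewrite /householder linearB /= linearZ /= trmx1 trmx_mul trmxK. Qed.

Lemma mul_householder d (u v : 'rV[R]_d) :
  u *m householder v = u - (2 * dot u v / dot v v) *: v.
Proof.
rewrite /householder mulmxBr mulmx1 -scalemxAr mulmxA [u *m v^T]mx11_scalar -/(dot u v).
by rewrite mul_scalar_mx scalerA mulrAC.
Qed.

Lemma householder_orth d (v : 'rV[R]_d) : v != 0 ->
  (householder v)^T *m householder v = 1%:M.
Proof.
move=> v0; have vv : dot v v != 0 by apply: contra_neq v0; exact: dot_eq0.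
apply/row_matrixP => i; rewrite householder_tr !rowE mulmx1 mulmxA !mul_householder.
move: (delta_mx _ _ : 'rV_d) => u; set c := 2 * dot u v / dot v v.
have -> : dot (u - c *: v) v = dot u v - c * dot v v.
  by rewrite dotBl; congr (_ - _); rewrite /dot -scalemxAl mxE.
rewrite -addrA -opprD -scalerDl (_ : c + _ = 0) ?scale0r ?subr0 //.
by rewrite /c; field.
Qed.

(* Row by row: the reflection in q_k - p_k sends p_k to q_k and, the Gram
   matrices being equal, fixes the rows already adjusted. *)
Lemma gram_eq_orth m d (P Q : 'M[R]_(m, d)) : P *m P^T = Q *m Q^T ->
  exists2 O : 'M[R]_d, O^T *m O = 1%:M & Q = P *m O.
Proof.
move=> PQ.
suff H k : exists2 O : 'M[R]_d, O^T *m O = 1%:M &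
    forall i : 'I_m, (i < k)%N -> row i (P *m O) = row i Q.
  by have [O OO OE] := H m; exists O => //; apply/row_matrixP => i; rewrite OE.
elim: k => [|k [O OO OE]]; first by exists 1%:M; rewrite ?trmx1 ?mulmx1.
have [km|mk] := ltnP k m; last first.
  by exists O => // i _; apply: OE; apply: leq_trans mk.
pose k' := Ordinal km.
have Gram i j : dot (row i (P *m O)) (row j (P *m O)) = dot (row i Q) (row j Q).
  by rewrite -!gramE trmx_mul mulmxA -(mulmxA P) (mulmx1C OO) mulmx1 PQ.
pose v := row k' Q - row k' (P *m O).
have [v0|v0] := eqVneq v 0.
  exists O => // i; rewrite ltnS leq_eqVlt => /orP[/eqP ik|]; last exact: OE.
  have -> : i = k' by exact: val_inj.
  by apply/esym/eqP; rewrite -subr_eq0; apply/eqP.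
have vv : dot v v != 0 by apply: contra_neq v0; exact: dot_eq0.
exists (O *m householder v).
  by rewrite trmx_mul -mulmxA (mulmxA O^T) OO mul1mx householder_orth.
move=> i; rewrite mulmxA row_mul mul_householder ltnS leq_eqVlt => /orP[/eqP ik|ik].
  have {ik} -> : i = k' by exact: val_inj.
  have -> : 2 * dot (row k' (P *m O)) v / dot v v = -1.
    apply/eqP; rewrite -(inj_eq (mulIf vv)) divfK // /v dotBl !dotBr.
    by rewrite Gram (dotC _ (row k' (P *m O))); apply/eqP; ring.
  by rewrite scaleN1r opprK /v addrC subrK.
have -> : dot (row i (P *m O)) v = 0.
  by rewrite /v dotBr Gram OE // subrr.
by rewrite mulr0 mul0r scale0r subr0 OE.
Qed.

Lemma orth_det d (O : 'M[R]_d) : O^T *m O = 1%:M -> \det O = 1 \/ \det O = -1.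
Proof.
move=> /(congr1 (fun M => \det M)); rewrite det_mulmx det_tr det1 -expr2 => /eqP.
by rewrite sqrf_eq1 => /orP[] /eqP; [left|right].
Qed.

Definition flip d : 'M[R]_d.+1 := diag_mx (\row_j (if j == ord0 then -1 else 1)).

Lemma flip_tr d : (flip d)^T = flip d. Proof. exact: tr_diag_mx. Qed.

Lemma flip_flip d : flip d *m flip d = 1%:M.
Proof.
rewrite /flip mulmx_diag -diag_const_mx; congr diag_mx; apply/rowP => j; rewrite !mxE.
by case: eqP; rewrite ?mulrNN mulr1.
Qed.

Lemma det_flip d : \det (flip d) = -1.
Proof.
rewrite det_diag big_ord_recl !mxE eqxx big1 ?mulr1 // => j _.
by rewrite mxE.
Qed.

(** Some [v != 0] is orthogonal to all rows. The reflection along [v] is written as a conjugate of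
    [flip] by a [U] taking [v] to the first axis, which shows its determinant. *)
Lemma reflection_fixing m d (P : 'M[R]_(m, d)) : (\rank P < d)%N ->
  exists O : 'M[R]_d, [/\ O^T *m O = 1%:M, \det O = -1 & P *m O = P].
Proof.
move=> rP.
have [v v0 Pv] : exists2 v : 'rV[R]_d, v != 0 & P *m v^T = 0.
  have : kermx P^T != 0 by rewrite -mxrank_eq0 mxrank_ker mxrank_tr subn_eq0 -ltnNge.
  case/rowV0Pn => v /sub_kermxP vP v0; exists v => //.
  by apply: trmx_inj; rewrite trmx_mul trmxK vP trmx0.
case: d P rP v v0 Pv => // d P rP v v0 Pv.
pose e : 'rV[R]_d.+1 := Num.sqrt (dot v v) *: delta_mx ord0 ord0.
have [|U UU eE] := @gram_eq_orth _ _ v e.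
  rewrite [LHS]mx11_scalar [RHS]mx11_scalar -/(dot v v) -/(dot e e); congr (_%:M).
  rewrite [dot e e]dotE (bigD1 ord0) //= big1 => [|j j0]; last first.
    by rewrite /e !mxE (negbTE j0) andbF mulr0 mul0r.
  by rewrite /e !mxE !eqxx mulr1 addr0 -expr2 sqr_sqrtr // dot_ge0.
have vv : dot v v != 0 by apply: contra_neq v0; exact: dot_eq0.
have s0 : Num.sqrt (dot v v) != 0 by rewrite sqrtr_eq0 -ltNge lt_def vv dot_ge0.
have UU' := mulmx1C UU.
have PU0 i : (P *m U) i ord0 = 0.
  have : P *m U *m (v *m U)^T = 0.
    by rewrite trmx_mul mulmxA -(mulmxA P) UU' mulmx1 Pv.
  rewrite -eE /e => /matrixP/(_ i ord0).
  rewrite linearZ /= -scalemxAr trmx_delta -colE !mxE => /eqP.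
  by rewrite mulf_eq0 (negbTE s0) => /eqP.
exists (U *m flip d *m U^T); split.
- rewrite !trmx_mul trmxK flip_tr !mulmxA -(mulmxA _ U^T U) UU mulmx1.
  by rewrite -(mulmxA U (flip d)) flip_flip mulmx1 UU'.
- rewrite !det_mulmx det_tr det_flip mulrAC -det_mulmx; have := orth_det UU.
  by rewrite det_mulmx => -[] ->; rewrite ?mulrNN !mulr1 ?mul1r.
rewrite !mulmxA (_ : P *m U *m flip d = P *m U); first by rewrite -mulmxA UU' mulmx1.
apply/matrixP => i j; rewrite mul_mx_diag [LHS]mxE [X in _ * X]mxE.
by case: eqP => [->|]; rewrite ?PU0 ?mul0r // mulr1.
Qed.

Lemma gram_eq_rotation m d (P Q : 'M[R]_(m, d)) : P *m P^T = Q *m Q^T ->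
  (\rank P < d)%N -> exists O : 'M[R]_d, [/\ O^T *m O = 1%:M, \det O = 1 & Q = P *m O].
Proof.
move=> /gram_eq_orth[O OO QE] rP.
have [dO|dO] := orth_det OO; first by exists O.
have [S [SS dS PS]] := reflection_fixing rP.
exists (S *m O); split.
- by rewrite trmx_mul -mulmxA (mulmxA S^T) SS mul1mx.
- by rewrite det_mulmx dO dS mulrNN mulr1.
- by rewrite mulmxA PS.
Qed.

Lemma gram_det m (P : 'M[R]_m) : \det (P *m P^T) = \det P ^+ 2.
Proof. by rewrite det_mulmx det_tr expr2. Qed.

Lemma gram_det0 m d (P : 'M[R]_(m, d)) : (d < m)%N -> \det (P *m P^T) = 0.
Proof.
move=> dm; apply/eqP; rewrite -[_ == 0]negbK -unitfE -unitmxE -row_free_unit /row_free.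
rewrite neq_ltn (leq_ltn_trans (mulmx_max_rank _ _)) ?orbT //.
Qed.

End Orthogonal.

(** * Positive semidefinite matrices *)

Section PSD.
Variable R : realType.

Definition qf m (G : 'M[R]_m) (x : 'rV[R]_m) : R := (x *m G *m x^T) ord0 ord0.

Definition psd m (G : 'M[R]_m) : Prop := G^T = G /\ forall x, 0 <= qf G x.

Lemma qfD m (G H : 'M[R]_m) x : qf (G + H) x = qf G x + qf H x.
Proof. by rewrite /qf mulmxDr mulmxDl mxE. Qed.

Lemma qfZ m a (G : 'M[R]_m) x : qf (a *: G) x = a * qf G x.
Proof. by rewrite /qf -scalemxAr -scalemxAl mxE. Qed.

Lemma qf_gram m d (P : 'M[R]_(m, d)) x : qf (P *m P^T) x = dot (x *m P) (x *m P).
Proof. by rewrite /qf /dot trmx_mul !mulmxA. Qed.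

Lemma psd_gram m d (P : 'M[R]_(m, d)) : psd (P *m P^T).
Proof.
split; first by rewrite trmx_mul trmxK.
by move=> x; rewrite qf_gram dot_ge0.
Qed.

Lemma psdD m (G H : 'M[R]_m) : psd G -> psd H -> psd (G + H).
Proof.
move=> [Gs Gp] [Hs Hp]; split; first by rewrite linearD /= Gs Hs.
by move=> x; rewrite qfD addr_ge0.
Qed.

Lemma psdZ m a (G : 'M[R]_m) : 0 <= a -> psd G -> psd (a *: G).
Proof.
move=> a0 [Gs Gp]; split; first by rewrite linearZ /= Gs.
by move=> x; rewrite qfZ mulr_ge0.
Qed.

Lemma addmx00 (A B : 'M[R]_1) : (A + B) ord0 ord0 = A ord0 ord0 + B ord0 ord0.
Proof. by rewrite mxE. Qed.

Lemma scalemx00 t (A : 'M[R]_1) : (t *: A) ord0 ord0 = t * A ord0 ord0.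
Proof. by rewrite mxE. Qed.

(** Cholesky factorization, by induction on the Schur complement of the corner entry [a]. *)
Lemma psd_factor m (G : 'M[R]_m) : psd G -> exists L : 'M[R]_m, G = L *m L^T.
Proof.
elim: m G => [|m IH] G.
  by exists 0; apply/matrixP => -[].
rewrite -[m.+1]/(1 + m)%N in G *.
move=> [Gs Gp].
pose a := G ord0 ord0; pose b : 'rV[R]_m := ursubmx G; pose D : 'M[R]_m := drsubmx G.
have aE : ulsubmx G = a%:M.
  by rewrite [ulsubmx G]mx11_scalar; congr (_%:M); rewrite !mxE; congr (G _ _); apply: val_inj.
have bE : dlsubmx G = b^T by rewrite /b trmx_ursub Gs.
have Ds : D^T = D by rewrite /D trmx_drsub Gs.
have GE : G = block_mx a%:M b b^T D by rewrite -aE -bE submxK.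
have qE (t : R) (y : 'rV[R]_m) : qf G (row_mx t%:M y) = t ^+ 2 * a + 2 * t * dot b y + qf D y.
  rewrite /qf {1}GE mul_row_block tr_row_mx mul_row_col !mulmxDl tr_scalar_mx.
  rewrite -!scalar_mxM !mul_scalar_mx -!scalemxAl !mul_mx_scalar.
  rewrite !addmx00 !scalemx00 [_%:M _ _]mxE eqxx.
  rewrite -[(y *m b^T) _ _]/(dot y b) -[(b *m y^T) _ _]/(dot b y) (dotC y b) mulr1n.
  by ring.
have a0 : 0 <= a.
  have := Gp (row_mx 1%:M 0); rewrite qE /dot /qf trmx0 !mulmx0 !mxE; lra.
have [az|an] := eqVneq a 0.
  have b0 : b = 0.
    apply: dot_eq0; apply/eqP; apply: contraT => w0.
    have w : 0 < dot b b by rewrite lt_def w0 dot_ge0.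
    (* With [a = 0] the form is affine in its first argument; this argument gives it the value
       -1. *)
    have := Gp (row_mx (- (qf D b + 1) / (2 * dot b b))%:M b); rewrite qE az.
    suff -> : 2 * (- (qf D b + 1) / (2 * dot b b)) * dot b b = - (qf D b + 1) by lra.
    by field.
  have [|L LE] := IH D.
    split=> // y; have := Gp (row_mx 0%:M y); rewrite qE az b0 /dot mul0mx mxE; lra.
  exists (block_mx 0 0 0 L).
  rewrite tr_block_mx !trmx0 mulmx_block !mul0mx !mulmx0 !addr0 add0r -LE.
  by rewrite GE az b0 trmx0 raddf0.
have ap : 0 < a by rewrite lt_def an.
have [|L LE] := IH (D - a^-1 *: (b^T *m b)).
  split; first by rewrite linearB /= linearZ /= trmx_mul trmxK Ds.
  (* The first argument minimizes the form for fixed [y]; the minimum is the Schur complement at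
     [y]. *)
  move=> y; have := Gp (row_mx (- dot b y / a)%:M y); rewrite qE.
  have -> : qf (D - a^-1 *: (b^T *m b)) y = qf D y - a^-1 * (dot b y) ^+ 2.
    rewrite qfD -scaleNr qfZ mulNr; congr (_ - _ * _).
    have -> : b^T *m b = b^T *m (b^T)^T by rewrite trmxK.
    rewrite qf_gram dotC [y *m b^T]mx11_scalar -[_ ord0 ord0]/(dot y b) (dotC y b).
    by move: (dot b y) => t; rewrite /dot tr_scalar_mx -scalar_mxM mxE eqxx mulr1n expr2.
  suff -> : (- dot b y / a) ^+ 2 * a + 2 * (- dot b y / a) * dot b y =
    - (a^-1 * dot b y ^+ 2) by lra.
  by field.
pose s := Num.sqrt a.
have ss : s * s = a by rewrite -expr2 sqr_sqrtr.
have s0 : s != 0 by rewrite sqrtr_eq0 -ltNge.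
exists (block_mx s%:M 0 (s^-1 *: b^T) L).
rewrite tr_block_mx mulmx_block !trmx0 !mulmx0 !mul0mx !addr0 -LE tr_scalar_mx -scalar_mxM ss.
rewrite linearZ /= trmxK mul_scalar_mx scalerA mulfV // scale1r.
rewrite -scalemxAl mul_mx_scalar scalerA mulVf // scale1r.
rewrite -scalemxAl -scalemxAr scalerA -invfM ss addrC subrK.
exact: GE.
Qed.

(** The substitution [y = x *m L], where [A = L *m L^T], turns [A] into the dot product and [S] into
    [M], bounded through its entries. *)
Lemma psd_unit_bound m (A S : 'M[R]_m) : psd A -> \det A != 0 ->
  exists2 C, 0 < C & forall x, `|qf S x| <= C * qf A x.
Proof.
move=> /psd_factor[L ->]; rewrite gram_det expf_eq0 => L0.
have Lu : L \in unitmx by rewrite unitmxE unitfE.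
pose M := invmx L *m S *m (invmx L)^T.
have s0 : 0 <= \sum_i \sum_j `|M i j| by apply: sumr_ge0 => i _; apply: sumr_ge0.
exists (\sum_i \sum_j `|M i j| + 1); first by rewrite ltr_wpDl.
move=> x; rewrite qf_gram; set y := x *m L.
have -> : qf S x = qf M y.
  rewrite /qf /M /y trmx_mul trmx_inv !mulmxA mulmxK // -!mulmxA; congr ((_ *m (_ *m _)) _ _).
  by rewrite mulKmx // unitmx_tr.
have yb i : `|y ord0 i| ^+ 2 <= dot y y.
  rewrite dotE (bigD1 i) //= -expr2 -normrX ger0_norm ?sqr_ge0 // lerDl.
  by apply: sumr_ge0 => j _; rewrite -expr2 sqr_ge0.
have yij i j : `|y ord0 i| * `|y ord0 j| <= dot y y.
  have := yb i; have := yb j; have := sqr_ge0 (`|y ord0 i| - `|y ord0 j|).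
  by rewrite sqrrB; lra.
apply: (@le_trans _ _ ((\sum_i \sum_j `|M i j|) * dot y y)); last first.
  by rewrite ler_wpM2r ?dot_ge0 // lerDl.
have -> : qf M y = \sum_i \sum_j M i j * (y ord0 i * y ord0 j).
  rewrite /qf mxE exchange_big /=; apply: eq_bigr => j _; rewrite !mxE mulr_suml.
  by apply: eq_bigr => i _; ring.
rewrite mulr_suml; apply: le_trans (ler_norm_sum _ _ _) _; apply: ler_sum => i _.
rewrite mulr_suml; apply: le_trans (ler_norm_sum _ _ _) _; apply: ler_sum => j _.
by rewrite normrM ler_wpM2l // normrM.
Qed.

Lemma qf_unit_eq0 m (A : 'M[R]_m) x : psd A -> \det A != 0 -> qf A x = 0 -> x = 0.
Proof.
move=> /psd_factor[L ->]; rewrite gram_det expf_eq0 qf_gram => L0 /dot_eq0 xL.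
have Lu : L \in unitmx by rewrite unitmxE unitfE.
by rewrite -[x](mulmxK Lu) xL mul0mx.
Qed.

End PSD.

(** * Edge lengths and a nondegenerate polygon *)

Section PlanarPolygon.
Variable R : realType.

(** A triangle, possibly degenerate, with side [B] laid along (1, 0); the other two sides get the
    unit directions [a] and [c]. *)
Lemma triangle_directions (A B C : R) : 0 <= A -> 0 < B -> 0 <= C ->
  A <= B + C -> B <= A + C -> C <= A + B ->
  exists a1 a2 c1 c2 : R, [/\ a1 ^+ 2 + a2 ^+ 2 = 1, c1 ^+ 2 + c2 ^+ 2 = 1,
    A * a1 + C * c1 = - B & A * a2 + C * c2 = 0].
Proof.
move=> A0 B0 C0 hA hB hC.
have [Az|An] := eqVneq A 0.
  exists 1, 0, (-1), 0; split; rewrite ?sqrrN ?expr1n ?expr0n ?addr0 //; last by lra.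
  by rewrite Az in hA hB hC *; lra.
have [Cz|Cn] := eqVneq C 0.
  exists (-1), 0, 1, 0; split; rewrite ?sqrrN ?expr1n ?expr0n ?addr0 //; last by lra.
  by rewrite Cz in hA hB hC *; lra.
have Ap : 0 < A by rewrite lt_def An.
have Bn : B != 0 by rewrite gt_eqF.
(* Law of cosines: [C c = - (B, 0) - A a] has squared length [A^2 + B^2 + 2 A B a1]. *)
pose a1 := (C ^+ 2 - A ^+ 2 - B ^+ 2) / (2 * A * B).
have a1E : 2 * A * B * a1 = C ^+ 2 - A ^+ 2 - B ^+ 2.
  by rewrite /a1; field; rewrite An Bn.
have AB : 0 < 2 * A * B by rewrite !mulr_gt0.
have a1b : -1 <= a1 <= 1.
  apply/andP; split; rewrite -(ler_pM2l AB) a1E; nra.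
have a11 : 0 <= 1 - a1 ^+ 2 by nra.
pose a2 := Num.sqrt (1 - a1 ^+ 2).
have a2E : a2 ^+ 2 = 1 - a1 ^+ 2 by rewrite sqr_sqrtr.
exists a1, a2, ((- B - A * a1) / C), (- A * a2 / C); split.
- by rewrite a2E; ring.
- have -> : ((- B - A * a1) / C) ^+ 2 + (- A * a2 / C) ^+ 2 =
     (B ^+ 2 + 2 * A * B * a1 + A ^+ 2 * a1 ^+ 2 + A ^+ 2 * a2 ^+ 2) / C ^+ 2 by field.
  by rewrite a2E a1E; field.
- by field.
- by field.
Qed.

(* If no w k exceeds the sum of the others, cut the list of lengths into a prefix
   A, a single length B and a suffix C, none exceeding half of the total: they
   are the sides of a triangle, which yields a closed polygon.  Otherwise align
   all other vectors against the longest one. *)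
Lemma planar_short_sum m (w : 'I_m -> R) (r : R) : 0 < r -> (0 < m)%N ->
  (forall i, 0 < w i) -> (forall i, 2 * w i < \sum_j w j + r) ->
  exists u v : 'I_m -> R, (forall i, u i ^+ 2 + v i ^+ 2 = w i ^+ 2) /\
    (\sum_i u i) ^+ 2 + (\sum_i v i) ^+ 2 < r ^+ 2.
Proof.
move=> r0 m0 w0 wr; set L := \sum_j w j in wr *.
have L0 : 0 < L.
  rewrite /L (bigD1 (Ordinal m0)) //= ltr_pwDl // sumr_ge0 // => j _; exact: ltW.
pose S (i : nat) := \sum_(j < m | (j < i)%N) w j.
have Sm : S m = L by apply: eq_bigl => j; rewrite ltn_ord.
have exi : exists i, L / 2 < S i by exists m; rewrite Sm; lra.
(* The entry [k] is where the partial sums pass half of the total: prefix and suffix are then at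
   most [L / 2], and only [w k'] may be larger. *)
case: (ex_minnP exi) => -[|k] hk kmin.
  by move: hk; rewrite /S big_pred0 //; lra.
have km : (k < m)%N.
  by apply: kmin; rewrite Sm; lra.
have Sk : S k <= L / 2.
  by rewrite leNgt; apply/negP => /kmin; rewrite ltnn.
pose k' := Ordinal km.
have SkS : S k.+1 = S k + w k'.
  rewrite /S (bigD1 k') //= addrC; congr (_ + _); apply: eq_bigl => j.
  by rewrite -val_eqE /= ltnS ltn_neqAle andbC.
have SkE : \sum_(j < m | (k < j)%N) w j = L - S k.+1.
  apply/eqP; rewrite eq_sym subr_eq addrC /L (bigID (fun j : 'I_m => (j < k.+1)%N)) /=; apply/eqP.
  by congr (_ + _); apply: eq_bigl => j; rewrite -leqNgt.
have split3 (f : 'I_m -> R) : \sum_j f j =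
    \sum_(j < m | (j < k)%N) f j + f k' + \sum_(j < m | (k < j)%N) f j.
  rewrite (bigID (fun j : 'I_m => (j < k)%N)) /= -addrA; congr (_ + _).
  rewrite (bigD1 k') ?ltnn //=; congr (_ + _); apply: eq_bigl => j.
  by rewrite -leqNgt -val_eqE /= [RHS]ltn_neqAle eq_sym andbC.
have S0 : 0 <= S k by apply: sumr_ge0 => j _; exact: ltW.
have C0 : 0 <= L - S k.+1 by rewrite -SkE; apply: sumr_ge0 => j _; exact: ltW.
have [wk|wk] := leP (w k') (L / 2); last first.
  exists (fun j => if j == k' then w j else - w j), (fun=> 0); split.
    by move=> i; case: eqP => _; rewrite ?sqrrN expr0n addr0.
  rewrite [X in _ + X ^+ 2]big1 // expr0n addr0 (bigD1 k') //= eqxx.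
  have -> : \sum_(i < m | i != k') (if i == k' then w i else - w i) = - (L - w k').
    rewrite /L [in RHS](bigD1 k') //= addrAC subrr add0r -sumrN.
    by apply: eq_bigr => j /negbTE ->.
  have := wr k'; rewrite ltr_sqr ?nnegrE; first by lra.
    by lra.
  exact: ltW.
rewrite SkS in hk C0 SkE; have wk0 := w0 k'.
have [] := @triangle_directions (S k) (w k') (L - (S k + w k')) S0 wk0 C0; try by lra.
move=> a1 [a2 [c1 [c2 [a12 c12 e1 e2]]]].
pose pick (x y z : R) (j : 'I_m) := w j * (if (j < k)%N then x else if j == k' then y else z).
have pickS x y z : \sum_j pick x y z j = S k * x + w k' * y + (L - (S k + w k')) * z.
  rewrite split3 -SkE /S !mulr_suml /pick ltnn eqxx; congr (_ + _ + _); apply: eq_bigr => j.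
    by move=> ->.
  by move=> kj; rewrite ltnNge ltnW //= -val_eqE /= gtn_eqF.
exists (pick a1 1 c1), (pick a2 0 c2); split.
  move=> i; rewrite /pick !exprMn -mulrDr.
  case: ifP => _; first by rewrite a12 mulr1.
  by case: ifP => _; rewrite ?expr1n ?expr0n ?addr0 ?c12 mulr1.
rewrite !pickS.
have -> : S k * a1 + w k' * 1 + (L - (S k + w k')) * c1 = 0 by lra.
have -> : S k * a2 + w k' * 0 + (L - (S k + w k')) * c2 = 0 by lra.
by rewrite expr0n addr0 exprn_gt0.
Qed.

Lemma posdef_det m (H : 'M[R]_m) : (forall x, qf H x = 0 -> x = 0) -> \det H != 0.
Proof.
move=> H0; apply/negP => /det0P[x x0 xH]; case/negP: x0; apply/eqP; apply: H0.
by rewrite /qf xH mul0mx mxE.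
Qed.

(* A convex combination of the orthogonal configuration with either a shorter
   planar one or the fully aligned one. *)
Lemma exists_center_edges m (w : 'I_m -> R) (r : R) : 0 < r -> (1 < m)%N ->
  (forall i, 0 < w i) -> (forall i, 2 * w i < \sum_j w j + r) -> r < \sum_j w j ->
  exists H : 'M[R]_m, [/\ psd H, \det H != 0, forall i, H i i = w i ^+ 2 &
    qf H (const_mx 1) = r ^+ 2].
Proof.
move=> r0 m1 w0 wr rw.
pose HD : 'M[R]_m := diag_mx (\row_i w i ^+ 2).
pose one : 'rV[R]_m := const_mx 1.
have qD x : qf HD x = \sum_i (w i * x ord0 i) ^+ 2.
  rewrite /qf mul_mx_diag mxE; apply: eq_bigr => i _; rewrite !mxE; ring.
have HDp : psd HD.
  by split; [exact: tr_diag_mx|move=> x; rewrite qD sumr_ge0 // => i _; exact: sqr_ge0].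
have HD0 x : qf HD x = 0 -> x = 0.
  rewrite qD => /eqP; rewrite psumr_eq0 => [/allP h|i _]; last exact: sqr_ge0.
  apply/rowP => i; rewrite mxE; apply/eqP.
  by have := h i (mem_index_enum _); rewrite sqrf_eq0 mulf_eq0 gt_eqF.
have HDi i : HD i i = w i ^+ 2 by rewrite !mxE eqxx.
have mix (G : 'M[R]_m) (s : R) : psd G -> (forall i, G i i = w i ^+ 2) -> 0 <= s < 1 ->
    let H := (1 - s) *: HD + s *: G in [/\ psd H, \det H != 0 & forall i, H i i = w i ^+ 2].
  move=> Gp Gi /andP[s0 s1]; split.
  - by apply: psdD; apply: psdZ => //; lra.
  - apply: posdef_det => x; rewrite qfD !qfZ => q0; apply: HD0.
    have p1 : 0 <= (1 - s) * qf HD x by apply: mulr_ge0; [lra|exact: HDp.2].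
    have p2 : 0 <= s * qf G x by apply: mulr_ge0; [|exact: Gp.2].
    have : (1 - s) * qf HD x = 0 by clear -p1 p2 q0; lra.
    move/eqP; rewrite mulf_eq0 => /orP[/eqP h|/eqP //]; by clear -s1 h; lra.
  - move=> i; have scE a (M : 'M[R]_m) : (a *: M) i i = a * M i i by rewrite mxE.
    by rewrite mxE !scE HDi Gi; ring.
pose d := qf HD one; pose w2 := \sum_i w i ^+ 2.
have dE : d = w2 by rewrite /d qD; apply: eq_bigr => i _; rewrite mxE mulr1.
suff [G [Gp Gi /orP Gq]] : exists G : 'M[R]_m, [/\ psd G, forall i, G i i = w i ^+ 2 &
   (qf G one < r ^+ 2 <= d) || (d <= r ^+ 2 < qf G one)].
  (* [s] solves [(1 - s) d + s qf G one = r^2]. As [s < 1], a positive multiple of the nondegenerate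
     [HD] remains in the mixture. *)
  pose s := (r ^+ 2 - d) / (qf G one - d).
  have dn : qf G one - d != 0.
    by rewrite subr_eq0; case: Gq => /andP[h1 h2]; [rewrite lt_eqF //; lra|rewrite gt_eqF //; lra].
  have sb : 0 <= s < 1.
    case: Gq => /andP[h1 h2].
      have n0 : 0 < d - qf G one by lra.
      have -> : s = (d - r ^+ 2) / (d - qf G one) by rewrite /s; field; rewrite dn; lra.
      by apply/andP; split; [apply: divr_ge0; lra|rewrite ltr_pdivrMr //; lra].
    have n0 : 0 < qf G one - d by lra.
    by apply/andP; split; [apply: divr_ge0; lra|rewrite ltr_pdivrMr //; lra].
  have [h1 h2 h3] := mix G s Gp Gi sb.
  exists ((1 - s) *: HD + s *: G); split=> //.
  by rewrite qfD !qfZ -/one -/d /s; field.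
have [rd|dr] := leP (r ^+ 2) d.
  have [u [v [uv uvr]]] := planar_short_sum r0 (ltnW m1) w0 wr.
  pose e : 'M[R]_(m, 1 + 1) := row_mx (\col_i u i) (\col_i v i).
  have eE : e *m e^T = (\col_i u i) *m (\col_i u i)^T + (\col_i v i) *m (\col_i v i)^T.
    by rewrite /e tr_row_mx mul_row_col.
  exists (e *m e^T); split; first exact: psd_gram.
    by move=> i; rewrite eE !mxE !big_ord1 !mxE -!expr2.
  rewrite (_ : qf _ _ = (\sum_i u i) ^+ 2 + (\sum_i v i) ^+ 2) ?uvr //.
  have one_col (f : 'I_m -> R) : one *m (\col_i f i) = (\sum_i f i)%:M.
    rewrite [LHS]mx11_scalar; congr (_%:M); rewrite mxE; apply: eq_bigr => i _.
    by rewrite !mxE mul1r.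
  rewrite eE qfD !qf_gram !one_col /dot !tr_scalar_mx -!scalar_mxM !mxE eqxx !mulr1n.
  by rewrite -!expr2.
exists ((\col_i w i) *m (\col_i w i)^T); split; first exact: psd_gram.
  by move=> i; rewrite mxE big_ord1 !mxE expr2.
apply/orP; right; rewrite ltW //=.
rewrite (_ : qf _ _ = (\sum_i w i) ^+ 2).
  by rewrite ltr_sqr ?nnegrE //; lra.
rewrite qf_gram (_ : one *m _ = (\sum_i w i)%:M).
  by rewrite /dot tr_scalar_mx -scalar_mxM mxE eqxx expr2.
rewrite [LHS]mx11_scalar; congr (_%:M); rewrite mxE; apply: eq_bigr => i _.
by rewrite !mxE mul1r.
Qed.

End PlanarPolygon.

Section EdgeCoordinates.
Variables (R : realType) (m : nat).
Implicit Type l : 'I_m.+1 -> R.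

(* Coefficients of the k-th edge vector in terms of the vertices, see [edge_mul]. *)
Definition edge (k : nat) : 'rV[R]_m :=
  @vtx R m.+1 m (1%:M : 'M[R]_m) k.+1 - @vtx R m.+1 m (1%:M : 'M[R]_m) k.

Lemma vtx_mul d d' (P : 'M[R]_(m, d)) (Q : 'M[R]_(d, d')) i :
  @vtx R m.+1 d' (P *m Q) i = @vtx R m.+1 d P i *m Q.
Proof.
rewrite /vtx; case: insubP => [k _ _|_]; last by rewrite mul0mx.
by case: ifP => _; rewrite ?row_mul ?mul0mx.
Qed.

Lemma edge_mul d (P : 'M[R]_(m, d)) k :
  edge k *m P = @vtx R m.+1 d P k.+1 - @vtx R m.+1 d P k.
Proof. by rewrite mulmxBl -!vtx_mul mul1mx. Qed.

(** Squared edge lengths are linear in the Gram matrix. *)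
Lemma VsetP l d (P : 'M[R]_(m, d)) : (forall k, 0 < l k) ->
  Vset l P <-> forall k : 'I_m.+1, qf (P *m P^T) (edge k) = l k ^+ 2.
Proof.
move=> l0.
have nE k : eucl_norm (@vtx R m.+1 d P k.+1 - @vtx R m.+1 d P k) =
    Num.sqrt (qf (P *m P^T) (edge k)).
  by rewrite /eucl_norm qf_gram edge_mul dotE; congr Num.sqrt.
split=> H k; have := H k.
  by rewrite nE => <-; rewrite sqr_sqrtr // qf_gram dot_ge0.
by rewrite nE => ->; rewrite sqrtr_sqr gtr0_norm.
Qed.

(** Each vertex is reached from the origin by at most [m] edges. Zero lengths are allowed because
    that case, where [P] must vanish, makes the gauge definite. *)
Lemma gram_bounded l d (P : 'M[R]_(m, d)) : (forall k, 0 <= l k) ->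
  (forall k : 'I_m.+1, qf (P *m P^T) (edge k) = l k ^+ 2) ->
  forall i j, `|P i j| <= m%:R * \sum_k l k.
Proof.
move=> l0 PE i j; set M := \sum_k l k.
have lM k : l k <= M by rewrite /M (bigD1 k) //= lerDl sumr_ge0.
have M0 : 0 <= M by exact: sumr_ge0.
have step (k : 'I_m.+1) : `|(edge k *m P) ord0 j| <= M.
  apply: le_trans (lM k); rewrite -ler_sqr ?nnegrE // -normrX ger0_norm ?sqr_ge0 //.
  rewrite -PE qf_gram dotE (bigD1 j) //= -expr2 lerDl sumr_ge0 // => q _.
  by rewrite -expr2 sqr_ge0.
have vb k : (k <= m)%N -> `|@vtx R m.+1 d P k ord0 j| <= k%:R * M.
  elim: k => [|k IH] km.
    rewrite mul0r /vtx; case: insubP => [? _ _|_] /=; by rewrite mxE normr0.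
  have kl : (k < m.+1)%N by apply: ltnW.
  have := step (Ordinal kl); rewrite /= edge_mul mxE [X in _ + X]mxE => h.
  rewrite -[vtx (n := m.+1) P k.+1 ord0 j](subrK (vtx (n := m.+1) P k ord0 j)).
  apply: le_trans (ler_normD _ _) _; rewrite -natr1 mulrDl mul1r addrC.
  by apply: lerD => //; apply: IH; exact: ltnW.
have -> : P i j = vtx (n := m.+1) P i.+1 ord0 j.
  rewrite /vtx /= insubT //= => ?; rewrite mxE; congr (P _ _); exact: val_inj.
apply: le_trans (vb _ _) _; first exact: ltn_ord.
by rewrite ler_wpM2r // ler_nat; exact: ltn_ord.
Qed.

(* The rows of [partial_sums *m e] are the vertices of the polygon with edges [e]. *)
Definition partial_sums : 'M[R]_m := \matrix_(i, j) (j <= i)%:R.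

Lemma det_partial_sums : \det partial_sums = 1.
Proof.
rewrite det_trig; first by apply: big1 => i _; rewrite mxE leqnn.
by apply/is_trig_mxP => i j ij; rewrite mxE leqNgt ij.
Qed.

Lemma vtx_partial_sums k j : vtx (n := m.+1) partial_sums k ord0 j = ((j < k) && (k <= m))%N%:R.
Proof.
rewrite /vtx; case: k => [|k] /=; first by case: insubP => [? _ _|_] /=; rewrite mxE.
case: insubP => [i _ <-|]; first by rewrite !mxE ltnS ltn_ord andbT.
by rewrite -leqNgt mxE [(k < m)%N]ltnNge => -> ; rewrite andbF.
Qed.

Lemma edge_partial_sums (k : 'I_m) : edge k *m partial_sums = delta_mx ord0 k.
Proof.
rewrite edge_mul; apply/rowP => j; rewrite mxE [X in _ + X]mxE !vtx_partial_sums !mxE eqxx /=.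
rewrite ltn_ord andbT (ltnW (ltn_ord k)) andbT ltnS -val_eqE /=.
by case: (ltngtP j k) => _; rewrite ?subrr ?subr0.
Qed.

Lemma last_edge_partial_sums : edge m *m partial_sums = const_mx (-1).
Proof.
rewrite edge_mul; apply/rowP => j; rewrite mxE [X in _ + X]mxE !vtx_partial_sums !mxE.
by rewrite ltnn andbF leqnn ltn_ord sub0r.
Qed.

(** [H] is the Gram matrix of the first [m] edges; the last edge closes the polygon, so its squared
    length is [qf H] at the all-ones row. Conjugation by [partial_sums] passes from edges to
    vertices. *)
Lemma exists_center l : (1 < m)%N -> int_Cn l ->
  exists c : 'M[R]_m, [/\ psd c, \det c != 0 &
    forall k : 'I_m.+1, qf c (edge k) = l k ^+ 2].
Proof.
move=> m1 lC.
pose w (i : 'I_m) := l (widen_ord (leqnSn m) i).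
have lS i : l i + l i < \sum_j w j + l ord_max.
  by rewrite -big_ord_recr (bigD1 i) //= ltrD2l; exact: (lC i).2.
have [||i|i||H [Hp H0 Hi Hr]] := @exists_center_edges R m w (l ord_max) => //.
- exact: (lC _).1.
- exact: (lC _).1.
- by have := lS (widen_ord (leqnSn m) i); rewrite mulr_natl.
- by have := lS ord_max; rewrite ltrD2r.
exists (partial_sums *m H *m partial_sums^T).
have qE x : qf (partial_sums *m H *m partial_sums^T) x = qf H (x *m partial_sums).
  by rewrite /qf trmx_mul !mulmxA.
split.
- split; first by rewrite !trmx_mul trmxK Hp.1 mulmxA.
  by move=> x; rewrite qE; exact: Hp.2.
- by rewrite !det_mulmx det_tr det_partial_sums mul1r mulr1.
move=> k; rewrite qE; case: (ltnP k m) => km.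
  rewrite (edge_partial_sums (Ordinal km)) /qf trmx_delta -rowE -colE !mxE Hi.
  by congr (l _ ^+ 2); apply: val_inj.
have kE : k = ord_max by apply: val_inj; apply/eqP; rewrite eqn_leq km -ltnS ltn_ord.
rewrite kE /= last_edge_partial_sums -Hr.
have -> : const_mx (-1) = - const_mx 1 :> 'rV[R]_m by apply/rowP => j; rewrite !mxE.
by rewrite /qf linearN /= mulNmx mulmxN mulNmx opprK.
Qed.

End EdgeCoordinates.

(** * The moduli spaces *)

Section CompactLift.

Lemma compact_set_type (X : topologicalType) (A : set X) :
  compact A -> compact [set: set_type A].
Proof.
move=> cA F FF _.
have [|x [Ax clx]] := cA (set_val @ F) _.
  by rewrite /fmap /=; apply: (@filterS _ F _ setT) filterT => y _; exact: (set_valP y).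
exists (exist _ x (mem_set Ax)); split=> // S U FS [W [[O oO OW] Wx WU]].
have [||y [[z Sz zy] Oy]] := clx (set_val @` S) O _ _.
- by rewrite /fmap /=; apply: (@filterS _ F _ S) FS => z Sz; exists z.
- by apply: open_nbhs_nbhs; split=> //; have := Wx; rewrite -OW.
by exists z; split=> //; apply: WU; rewrite -OW /= zy.
Qed.

(** By compactness [g] is a closed map, so the preimage of a closed [S] under the lift, [f @^-1] (g
    @[S)], is closed. *)
Lemma compact_lift (X Z T : topologicalType) (f : X -> T) (g : Z -> T) :
  hausdorff_space T -> compact [set: Z] -> continuous f -> continuous g ->
  injective g -> (forall x, exists z, g z = f x) ->
  exists2 u : X -> Z, continuous u & forall x, g (u x) = f x.
Proof.
move=> hT cZ cf cg gi /choice[u uE]; exists u => //.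
apply/continuous_closedP => S clS.
have -> : u @^-1` S = f @^-1` (g @` S).
  apply/seteqP; split => x /=; first by move=> Sx; exists (u x).
  by move=> [z Sz]; rewrite -uE => /gi <-.
have /continuous_closedP := cf; apply; apply: compact_closed => //.
apply: continuous_compact; first exact: continuous_subspaceT.
by apply: subclosed_compact clS cZ _.
Qed.

Lemma compact_bijection_homeo (X Z T : topologicalType) (f : X -> T) (g : Z -> T) :
  hausdorff_space T -> compact [set: X] -> compact [set: Z] ->
  continuous f -> continuous g -> injective f -> injective g ->
  (forall x, exists z, g z = f x) -> (forall z, exists x, f x = g z) ->
  homeomorphic X Z.
Proof.
move=> hT cX cZ cf cg fi gi fg gf.
have [u uc uE] := compact_lift hT cZ cf cg gi fg.
have [v vc vE] := compact_lift hT cX cg cf fi gf.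
by exists u, v; split=> // x; [apply: fi|apply: gi]; rewrite ?vE ?uE ?vE.
Qed.

(** Where [f] is nonzero its sign is locally constant; where it vanishes the product is squeezed by
    [|k|]. *)
Lemma continuous_sgr_mul (R : realType) (T : topologicalType) (f k : T -> R) :
  continuous f -> continuous k -> (forall x, f x = 0 -> k x = 0) ->
  continuous (fun x => Num.sg (f x) * k x).
Proof.
move=> cf ck fk x; have [fx|fx] := eqVneq (f x) 0.
  apply/cvgrPdist_lt => e e0; rewrite fx sgr0 mul0r.
  have /cvgrPdist_lt/(_ e e0) := ck x; apply: filterS => y; rewrite (fk x fx) !sub0r !normrN.
  by apply: le_lt_trans; rewrite normrM normr_sg; case: eqP; rewrite ?mul0r ?mul1r.
have /cvgrPdist_lt/(_ `|f x|) : f @ x --> f x by exact: cf.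
rewrite normr_gt0 => /(_ fx) fn.
have E : \forall y \near x, Num.sg (f x) * k y = Num.sg (f y) * k y.
  apply: filterS fn => y fy; congr (_ * _); move: fy fx; clear.
  move: (f x) (f y) => a b; rewrite neq_lt => ab /orP[a0|a0].
    rewrite !ltr0_sg //; move: ab; rewrite (ltr0_norm a0) ltr_norml => /andP[]; lra.
  rewrite !gtr0_sg //; move: ab; rewrite (gtr0_norm a0) ltr_norml => /andP[]; lra.
apply: cvg_trans (near_eq_cvg E) _.
by apply: cvgM; [exact: cvg_cst|exact: ck].
Qed.

End CompactLift.

Section ModuliSpace.
Variables (R : realType) (m : nat) (l : 'I_m.+1 -> R).
Hypothesis l0 : forall k, 0 < l k.

Lemma compact_mx_ball p q (b : R) : compact [set M : 'M[R]_(p, q) | `|M| <= b].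
Proof.
have [b0|b0] := leP 0 b; last first.
  rewrite (_ : [set _ | _] = set0); first exact: compact0.
  by apply/seteqP; split=> // M /= Mb; have := le_lt_trans Mb b0; rewrite normr_lt0.
have -> : [set M : 'M[R]_(p, q) | `|M| <= b] = vec_mx @` [set v | `|v| <= b].
  apply/seteqP; split => [M Mb|_ [v vb <-]] /=.
    exists (mxvec M); last exact: mxvecK.
    apply/mx_norm_leP => // i j; rewrite ord1; case/mxvec_indexP: j => a c; rewrite mxvecE.
    exact: le_trans (entry_le_norm _ _ _) Mb.
  by apply/mx_norm_leP => // i j; rewrite mxE; exact: le_trans (entry_le_norm _ _ _) vb.
apply: continuous_compact; last exact: compact_row_ball.
apply: continuous_subspaceT; apply/continuous_mxP => i j.
by under eq_fun do rewrite mxE; exact: coord_continuous.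
Qed.

Lemma continuous_gram d : continuous (fun P : 'M[R]_(m, d) => P *m P^T).
Proof.
apply: continuous_mulmx; first exact: continuous_id.
by apply: continuous_trmx; exact: continuous_id.
Qed.

Lemma compact_Vset d : compact (@Vset R m.+1 l d).
Proof.
apply: (@subclosed_compact _ _ [set M : 'M[R]_(m, d) | `|M| <= m%:R * \sum_k l k]).
- have -> : @Vset R m.+1 l d = \bigcap_(k in [set: 'I_m.+1])
      (fun P : 'M[R]_(m, d) => qf (P *m P^T) (edge R m k)) @^-1` [set l k ^+ 2].
    apply/seteqP; split => P; first by move=> /(VsetP P l0) H k _; exact: H.
    by move=> H; apply/(VsetP P l0) => k; exact: H.
  apply: closed_bigI => k _; apply: preimage_closed; last exact: closed_eq.
  move=> P _.
  suff : continuous (fun P : 'M[R]_(m, d) => qf (P *m P^T) (edge R m k)) by apply.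
  apply: ((continuous_mxP _).1 _ ord0 ord0).
  apply: continuous_mulmx; last exact: cst_continuous.
  by apply: continuous_mulmx; [exact: cst_continuous|exact: continuous_gram].
- exact: compact_mx_ball.
move=> P /(VsetP P l0) PE /=; apply/mx_norm_leP.
  by rewrite mulr_ge0 // sumr_ge0 // => k _; exact: ltW.
by move=> i j; apply: gram_bounded => // k; exact: ltW.
Qed.

Section Dimension.
Variable d : nat.
Local Notation M := (@Mspace R m.+1 l d).
Local Notation V := (@Vtype R m.+1 l d).

Definition pi (x : V) : M := \pi_(quotient_topology {eq_quot (@orbit_equiv R m.+1 l d)}) x.
(** A chosen representative, with no continuity claimed: maps written through [rep] are continuous
    by invariance under rotations. *)
Definition rep (x : M) : 'M[R]_(m, d) := set_val (repr x : V).

Lemma repK (x : M) : pi (repr x) = x. Proof. exact: reprK. Qed.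

Lemma Mspace_pi_continuous : continuous pi. Proof. exact: pi_continuous. Qed.

Lemma compact_Mspace : compact [set: M].
Proof.
have -> : [set: M] = pi @` [set: V].
  by apply/seteqP; split => x // _; exists (repr x) => //; exact: repK.
apply: continuous_compact; last by apply: compact_set_type; exact: compact_Vset.
by apply: continuous_subspaceT; exact: Mspace_pi_continuous.
Qed.

Lemma pi_eq (x y : V) (O : 'M[R]_d) : O^T *m O = 1%:M -> \det O = 1 ->
  set_val y = set_val x *m O -> pi x = pi y.
Proof.
move=> OO dO yE; apply/eqmodP/asboolP; exists O^T; last by rewrite /act trmxK.
by split; rewrite ?det_tr // trmxK; exact: mulmx1C.
Qed.

Lemma rep_pi (x : V) : exists O : 'M[R]_d,
  [/\ O^T *m O = 1%:M, \det O = 1 & rep (pi x) = set_val x *m O].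
Proof.
have /eqmodP/asboolP[Q [QQ dQ] E] : x = repr (pi x) %[mod {eq_quot (@orbit_equiv R m.+1 l d)}].
  by apply/esym; exact: reprK.
exists Q^T; rewrite det_tr; split=> //; rewrite trmxK; exact: mulmx1C.
Qed.

Lemma rep_Vset (x : M) : @Vset R m.+1 l d (rep x).
Proof. exact: set_valP. Qed.

Lemma rep_surj (P : 'M[R]_(m, d)) : @Vset R m.+1 l d P -> exists x : M,
  exists O : 'M[R]_d, [/\ O^T *m O = 1%:M, \det O = 1 & rep x = P *m O].
Proof. by move=> PV; exists (pi (exist _ P (mem_set PV))); exact: rep_pi. Qed.

Lemma rep_eq (x y : M) (O : 'M[R]_d) : O^T *m O = 1%:M -> \det O = 1 ->
  rep y = rep x *m O -> x = y.
Proof. by move=> OO dO /(pi_eq OO dO); rewrite !repK. Qed.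

Lemma invariant_continuous (T : topologicalType) (h : 'M[R]_(m, d) -> T) :
  continuous h -> (forall P (O : 'M[R]_d), O^T *m O = 1%:M -> \det O = 1 -> h (P *m O) = h P) ->
  continuous (fun x : M => h (rep x)).
Proof.
move=> hc hO; apply/quotient_continuous.
rewrite (_ : _ \o _ = h \o set_val); last first.
  by apply: funext => x /=; have [O [OO dO ->]] := rep_pi x; exact: hO.
by apply: (@continuous_compose _ _ _ _ h) => //; exact: initial_continuous.
Qed.

Definition gram (x : M) : 'M[R]_m := rep x *m (rep x)^T.

Lemma gram_orth (P : 'M[R]_(m, d)) (O : 'M[R]_d) : O^T *m O = 1%:M ->
  (P *m O) *m (P *m O)^T = P *m P^T.
Proof. by move=> OO; rewrite trmx_mul mulmxA -(mulmxA P) (mulmx1C OO) mulmx1. Qed.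

Lemma gram_continuous : continuous gram.
Proof.
apply: (@invariant_continuous _ (fun P => P *m P^T)); first exact: continuous_gram.
by move=> P O OO _; exact: gram_orth.
Qed.

Lemma gram_psd x : psd (gram x). Proof. exact: psd_gram. Qed.

Lemma gram_edge x (k : 'I_m.+1) : qf (gram x) (edge R m k) = l k ^+ 2.
Proof. by move: k; apply/(VsetP (rep x) l0); exact: rep_Vset. Qed.

Lemma gram_surj (G : 'M[R]_m) : (m <= d)%N -> psd G ->
  (forall k : 'I_m.+1, qf G (edge R m k) = l k ^+ 2) -> exists x, gram x = G.
Proof.
move=> md /psd_factor[L LE] GE.
pose P : 'M[R]_(m, d) := L *m pid_mx m.
have PE : P *m P^T = G.
  by rewrite /P trmx_mul mulmxA -(mulmxA L) tr_pid_mx pid_mx_id // pid_mx_1 mulmx1.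
have [|x [O [OO _ xE]]] := @rep_surj P; first by apply/(VsetP P l0); rewrite PE.
by exists x; rewrite /gram xE gram_orth.
Qed.

Lemma gram_inj : (m < d)%N -> injective gram.
Proof.
move=> md x y /gram_eq_rotation[|O [OO dO E]]; last exact: rep_eq OO dO E.
exact: leq_ltn_trans (rank_leq_row _) md.
Qed.

End Dimension.

Lemma high_dim_homeo d d' : (m < d)%N -> (m < d')%N ->
  homeomorphic (@Mspace R m.+1 l d) (@Mspace R m.+1 l d').
Proof.
move=> md md'.
apply: (@compact_bijection_homeo _ _ 'M[R]_m (@gram d) (@gram d')).
- exact: norm_hausdorff.
- exact: compact_Mspace.
- exact: compact_Mspace.
- exact: gram_continuous.
- exact: gram_continuous.
- exact: gram_inj.
- exact: gram_inj.
- by move=> x; apply: gram_surj; [exact: ltnW|exact: gram_psd|exact: gram_edge].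
- by move=> x; apply: gram_surj; [exact: ltnW|exact: gram_psd|exact: gram_edge].
Qed.

(** [flip] normalizes the rotation group, so multiplication by it descends to orbits. The matrix [O]
    depends on [x] because the representative of [s x] is a choice. *)
Lemma reflection_exists d (M := @Mspace R m.+1 l d) : (0 < d)%N ->
  exists2 s : M -> M, continuous s &
  forall x, exists O : 'M[R]_d, [/\ O^T *m O = 1%:M, \det O = -1 & rep (s x) = rep x *m O].
Proof.
case: d @M => // d' M _.
have ff := flip_flip R d'.
have flipV (P : 'M[R]_(m, d'.+1)) : @Vset R m.+1 l d'.+1 P -> @Vset R m.+1 l d'.+1 (P *m flip R d').
  move=> /(VsetP P l0) H; apply/(VsetP _ l0) => k.
  by rewrite gram_orth ?flip_tr ?H.
pose s0 (x : @Vtype R m.+1 l d'.+1) : @Vtype R m.+1 l d'.+1 :=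
  exist _ (set_val x *m flip R d') (mem_set (flipV _ (set_valP x))).
have s0c : continuous s0.
  apply/continuousP => A [O oO <-].
  have /continuousP : continuous (fun x : @Vtype R m.+1 l d'.+1 => set_val x *m flip R d').
    apply: continuous_mulmx; last exact: cst_continuous.
    exact: initial_continuous.
  by apply.
pose s (x : M) := pi (s0 (repr x)).
have sE x : exists O : 'M[R]_d'.+1, [/\ O^T *m O = 1%:M, \det O = -1 & rep (s x) = rep x *m O].
  have [O [OO dO E]] := rep_pi (s0 (repr x)).
  exists (flip R d' *m O); split.
  - by rewrite trmx_mul flip_tr -mulmxA (mulmxA (flip R d')) ff mul1mx.
  - by rewrite det_mulmx dO det_flip mulr1.
  - by rewrite /s E /= mulmxA.
exists s => //; apply/quotient_continuous.
rewrite (_ : s \o _ = @pi d'.+1 \o s0).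
  by apply: (@continuous_compose _ _ _ s0 (@pi d'.+1)) => //; exact: Mspace_pi_continuous.
apply: funext => x /=; rewrite /s.
have [O [OO dO E]] := rep_pi x.
apply: (@pi_eq _ _ _ (flip R d' *m O^T *m flip R d')).
- rewrite !trmx_mul trmxK flip_tr !mulmxA -(mulmxA _ (flip R d') (flip R d')) ff mulmx1.
  by rewrite -(mulmxA (flip R d') O) (mulmx1C OO) mulmx1 ff.
- by rewrite !det_mulmx det_tr dO det_flip mulr1 mulrNN mulr1.
change (set_val x *m flip R d' =
  rep (pi x) *m flip R d' *m (flip R d' *m O^T *m flip R d')).
rewrite E !mulmxA.
by rewrite -(mulmxA _ (flip R d') (flip R d')) ff mulmx1 -(mulmxA _ O) (mulmx1C OO) mulmx1.
Qed.

End ModuliSpace.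

(** * The gauge of the set of Gram matrices *)

Section Directions.
Variables (R : realType) (m : nat).

Lemma qf_mxvec (S : 'M[R]_m) (x : 'rV[R]_m) :
  qf S x = (mxvec S *m (mxvec (x^T *m x))^T) ord0 ord0.
Proof. by rewrite -[in RHS](trmxK (mxvec S)) -trmx_mul mxvec_dotmul mxE. Qed.

(** The rows of [B] are a basis of the space parallel to the affine edge equations on symmetric
    matrices; it is the kernel of the antisymmetrization [A1] and the edge functionals [A2]. *)
Lemma exists_directions : exists r (B : 'M[R]_(r, m * m)), row_free B /\
  forall S : 'M[R]_m, (mxvec S <= B)%MS <->
    (S^T = S /\ forall k : 'I_m.+1, qf S (edge R m k) = 0).
Proof.
pose A1 : 'M[R]_(m * m) := 1%:M - lin_mx (@trmx R m m).
pose A2 : 'M[R]_(m.+1, m * m) := \matrix_k mxvec ((edge R m k)^T *m edge R m k).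
pose K := kermx (row_mx A1 A2^T).
exists (\rank K), (row_base K); split; first exact: row_base_free.
move=> S; rewrite eq_row_base; split.
  move/sub_kermxP; rewrite mul_mx_row => /eqP; rewrite row_mx_eq0 => /andP[/eqP h1 /eqP h2].
  split.
    move: h1; rewrite /A1 mulmxBr mulmx1 mul_rV_lin mxvecK => /eqP.
    by rewrite subr_eq0 => /eqP/(can_inj mxvecK).
  move=> k; rewrite qf_mxvec; have /matrixP/(_ ord0 k) := h2.
  rewrite [RHS]mxE => <-; rewrite !mxE; apply: eq_bigr => j _; by rewrite !mxE.
move=> [Ss Sq]; apply/sub_kermxP; rewrite mul_mx_row; apply/eqP; rewrite row_mx_eq0.
apply/andP; split; apply/eqP.
  by rewrite /A1 mulmxBr mulmx1 mul_rV_lin mxvecK /= Ss subrr.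
apply/rowP => k; rewrite [RHS]mxE -(Sq k) qf_mxvec !mxE; apply: eq_bigr => j _; by rewrite !mxE.
Qed.

End Directions.

Section Gauge.
Variables (R : realType) (m r : nat) (c : 'M[R]_m) (B : 'M[R]_(r, m * m)).
Hypotheses (cp : psd c) (c0 : \det c != 0) (Bfree : row_free B).
Hypothesis BE : forall S : 'M[R]_m, (mxvec S <= B)%MS <->
  (S^T = S /\ forall k : 'I_m.+1, qf S (edge R m k) = 0).

Definition direction (v : 'rV[R]_r) : 'M[R]_m := vec_mx (v *m B).
Definition coordinates (S : 'M[R]_m) : 'rV[R]_r := mxvec S *m pinvmx B.

Lemma directionK : cancel direction coordinates.
Proof. by move=> v; rewrite /coordinates vec_mxK mulmxKp. Qed.

Lemma coordinatesK S : S^T = S -> (forall k : 'I_m.+1, qf S (edge R m k) = 0) ->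
  direction (coordinates S) = S.
Proof.
move=> Ss Sq; rewrite /direction /coordinates mulmxKpV ?mxvecK //.
by apply/BE.
Qed.

Lemma direction_sym v : (direction v)^T = direction v.
Proof. by have [|] := (BE (direction v)).1; rewrite ?vec_mxK ?submxMl. Qed.

Lemma direction_edge v (k : 'I_m.+1) : qf (direction v) (edge R m k) = 0.
Proof. by have [|] := (BE (direction v)).1; rewrite ?vec_mxK ?submxMl. Qed.

Lemma directionD u v : direction (u + v) = direction u + direction v.
Proof. by rewrite /direction mulmxDl linearD. Qed.

Lemma directionZ a v : direction (a *: v) = a *: direction v.
Proof. by rewrite /direction -scalemxAl linearZ. Qed.

Lemma direction0 : direction 0 = 0.
Proof. by rewrite /direction mul0mx linear0. Qed.

Lemma coordinates_continuous : continuous coordinates.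
Proof.
apply: continuous_mulmx; last exact: cst_continuous.
apply/continuous_mxP => i j; rewrite ord1.
case/mxvec_indexP: j => a b; under eq_fun do rewrite mxvecE.
exact: coord_continuous.
Qed.

Lemma psd_sym_pencil t v : (forall x, 0 <= qf (t *: c + direction v) x) ->
  psd (t *: c + direction v).
Proof. by split=> //; rewrite linearD linearZ /= cp.1 direction_sym. Qed.

Lemma direction_bound : exists2 K, 0 < K & forall v x, `|qf (direction v) x| <= K * `|v| * qf c x.
Proof.
have /choice[C CP] : forall i : 'I_r, exists C, 0 < C /\
    forall x, `|qf (vec_mx (row i B)) x| <= C * qf c x.
  by move=> i; have [C ? ?] := psd_unit_bound (vec_mx (row i B)) cp c0; exists C.
have S0 : 0 <= \sum_i C i by apply: sumr_ge0 => i _; rewrite ltW // (CP i).1.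
exists (\sum_i C i + 1); first by rewrite ltr_wpDl.
move=> v x; have qc := cp.2 x.
have -> : qf (direction v) x = \sum_i v ord0 i * qf (vec_mx (row i B)) x.
  rewrite qf_mxvec vec_mxK -mulmxA mxE; apply: eq_bigr => i _; congr (_ * _).
  by rewrite qf_mxvec vec_mxK -row_mul [RHS]mxE.
apply: le_trans (ler_norm_sum _ _ _) _.
apply: (@le_trans _ _ (\sum_i `|v| * (C i * qf c x))).
  apply: ler_sum => i _; rewrite normrM; apply: ler_pM => //; first exact: entry_le_norm.
  exact: (CP i).2.
rewrite -mulr_sumr -mulr_suml mulrA [leRHS]mulrAC -[leLHS]mulrA [leLHS]mulrC.
by rewrite ler_wpM2r // ler_wpM2r // lerDl.
Qed.

(** Minkowski gauge of the Gram matrices, seen from [c]. Scaling [c] rather than dividing [v] by [t]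
    admits [t = 0]. It need not be symmetric under [v |-> - v]. *)
Definition gauge v : R := inf [set t | 0 <= t /\ psd (t *: c + direction v)].

Lemma gauge_bound : exists2 K, 0 < K & forall v, gauge v <= K * `|v|.
Proof.
have [K K0 KP] := direction_bound; exists K => // v.
have lb : has_lbound [set t | 0 <= t /\ psd (t *: c + direction v)] by exists 0 => t [].
apply: (ge_inf lb); split; first by rewrite mulr_ge0 // ltW.
apply: psd_sym_pencil => x; rewrite qfD qfZ; have := KP v x; rewrite ler_norml; lra.
Qed.

Let gset_neq0 v : [set t | 0 <= t /\ psd (t *: c + direction v)] !=set0.
Proof.
have [K K0 KP] := direction_bound; exists (K * `|v|); split; first by rewrite mulr_ge0 // ltW.
apply: psd_sym_pencil => x; rewrite qfD qfZ; have := KP v x; rewrite ler_norml; lra.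
Qed.

Let gset_lb v : has_lbound [set t | 0 <= t /\ psd (t *: c + direction v)].
Proof. by exists 0 => t []. Qed.

Lemma gauge_ge0 v : 0 <= gauge v.
Proof. by apply: lb_le_inf => // t []. Qed.

(** The infimum is attained, since each inequality [0 <= qf _ x] is closed in [t], and enlarging [t]
    adds a multiple of [c]. *)
Lemma psd_pencil t v : gauge v <= t -> psd (t *: c + direction v).
Proof.
move=> gt; apply: psd_sym_pencil => x; rewrite qfD qfZ.
have a0 := cp.2 x; set a := qf c x in a0 *; set q := qf _ x.
suff : - q <= t * a by lra.
apply/ler_addgt0Pr => e e0.
have d0 : 0 < e / (a + 1) by rewrite divr_gt0 // ltr_wpDl.
have [s [s0 sp] sg] := inf_adherent d0 (conj (gset_neq0 v) (gset_lb v)).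
have := sp.2 x; rewrite qfD qfZ -/a -/q => h.
have : s * a <= (t + e / (a + 1)) * a.
  by rewrite ler_wpM2r //; apply: le_trans (ltW sg) _; rewrite lerD2r.
have : e / (a + 1) * a <= e.
  by rewrite mulrAC ler_pdivrMr ?ltr_wpDl // ler_pM2l // lerDl.
by rewrite mulrDl; lra.
Qed.

Lemma gauge_le t v : 0 <= t -> psd (t *: c + direction v) -> gauge v <= t.
Proof. by move=> t0 tp; apply: ge_inf. Qed.

Lemma gaugeD u v : gauge (u + v) <= gauge u + gauge v.
Proof.
apply: gauge_le; first by rewrite addr_ge0 ?gauge_ge0.
by rewrite directionD scalerDl addrACA; apply: psdD; exact: psd_pencil.
Qed.

Lemma gaugeZ_le a v : 0 <= a -> gauge (a *: v) <= a * gauge v.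
Proof.
move=> a0; apply: gauge_le; first by rewrite mulr_ge0 ?gauge_ge0.
by rewrite directionZ -scalerA -scalerDr; apply: psdZ => //; exact: psd_pencil.
Qed.

Lemma gaugeZ a v : 0 < a -> gauge (a *: v) = a * gauge v.
Proof.
move=> a0; apply/eqP; rewrite eq_le (gaugeZ_le _ (ltW a0)) /=.
have := @gaugeZ_le a^-1 (a *: v).
rewrite scalerA mulVf ?gt_eqF // scale1r invr_ge0 => /(_ (ltW a0)).
by rewrite mulrC ler_pdivlMr // mulrC.
Qed.

Lemma gauge0 : gauge 0 = 0.
Proof.
apply/eqP; rewrite eq_le gauge_ge0 andbT; apply: gauge_le => //.
rewrite scale0r direction0 addr0; split; first by rewrite trmx0.
by move=> x; rewrite /qf mulmx0 mul0mx mxE.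
Qed.

(** At gauge 0, [direction v] is the Gram matrix of a polygon all of whose edges have length 0. *)
Lemma gauge_gt0 v : v != 0 -> 0 < gauge v.
Proof.
move=> v0; rewrite lt_def gauge_ge0 andbT; apply: contra_neq v0 => g0.
have : psd (0 *: c + direction v) by apply: psd_pencil; rewrite g0.
rewrite scale0r add0r => /psd_factor[L LE].
have L0 : L = 0.
  apply/matrixP => i j; rewrite mxE; apply/eqP; rewrite -normr_le0.
  have := @gram_bounded R m (fun=> 0) m L _ _ i j; rewrite big1 // mulr0; apply => // k.
  by rewrite -LE direction_edge expr0n.
by rewrite -[v]directionK LE L0 mul0mx /coordinates linear0 mul0mx.
Qed.

Lemma gauge_continuous : continuous gauge.
Proof.
have [K K0 KP] := gauge_bound.
have H u v : gauge u - gauge v <= K * `|u - v|.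
  rewrite lerBlDl; apply: le_trans (_ : gauge v + gauge (u - v) <= _); last by rewrite lerD2l.
  by have := gaugeD v (u - v); rewrite addrC subrK.
apply: (@lipschitz_continuous R 'rV[R]_r R^o gauge K) => // u v.
by rewrite ler_norml H andbT lerNl opprB distrC H.
Qed.

Lemma gauge_lt1_det v : gauge v < 1 -> \det (c + direction v) != 0.
Proof.
move=> g1; apply: posdef_det => x.
have -> : c + direction v = (1 - gauge v) *: c + (gauge v *: c + direction v).
  by rewrite addrA -scalerDl subrK scale1r.
rewrite qfD qfZ => q0; apply: (qf_unit_eq0 cp c0).
have h1 := (psd_pencil (lexx (gauge v))).2 x; have h2 := cp.2 x.
have g1' : 0 < 1 - gauge v by lra.
have h3 : 0 <= (1 - gauge v) * qf c x by rewrite mulr_ge0 // ltW.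
have : (1 - gauge v) * qf c x = 0 by lra.
by move/eqP; rewrite mulf_eq0 gt_eqF //= => /eqP.
Qed.

(** A nondegenerate [c + direction v] dominates a small multiple [e] of [c], which can be
    subtracted, so the gauge is at most [1 - e]. *)
Lemma det_gauge_lt1 v : gauge v <= 1 -> \det (c + direction v) != 0 -> gauge v < 1.
Proof.
move=> g1 d0; have Ap : psd (c + direction v) by rewrite -[c]scale1r; exact: psd_pencil.
have [K K0 KP] := psd_unit_bound c Ap d0.
pose e := (K + 1)^-1.
have e0 : 0 < e by rewrite invr_gt0 addr_gt0.
have e1 : e <= 1 by rewrite invf_le1 ?lerDr ?ltW // addr_gt0.
suff : gauge v <= 1 - e by lra.
apply: gauge_le; first by rewrite subr_ge0.
apply: psd_sym_pencil => x; rewrite qfD qfZ.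
have := KP x; rewrite (ger0_norm (cp.2 x)) qfD => h.
have h' := Ap.2 x; rewrite qfD in h'.
have : e * qf c x <= e * (K * (qf c x + qf (direction v) x)) by rewrite ler_pM2l.
have : e * K <= 1 by rewrite mulrC ler_pdivrMr ?addr_gt0 // mul1r lerDl.
by move=> eK; have := ler_wpM2r h' eK; lra.
Qed.

End Gauge.

(** * Dimensions at most n - 1 *)

(* Near p0 = q x0 the projection along p0 is injective on the unit sphere of the gauge:
   if w = u - t p0 with 0 < t < 1 then w = (1 - t) u + t (u - p0) has gauge < 1. *)
Lemma no_embedding_in_sphere (R : realType) r (g : 'rV[R]_r -> R) (K d : R)
    (q : 'rV[R]_r -> 'rV[R]_r) (x0 : 'rV[R]_r) :
  0 < K -> (forall v, g v <= K * `|v|) -> (forall u v, g (u + v) <= g u + g v) ->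
  (forall a v, 0 <= a -> g (a *: v) <= a * g v) ->
  continuous q -> (forall x, g (q x) = 1) -> 0 < d ->
  ~ (forall x y, `|x - x0| <= d -> `|y - x0| <= d -> q x = q y -> x = y).
Proof.
move=> K0 gK gD gZ qc q1 d0 qi.
have p0 : q x0 != 0.
  apply/eqP => q0; have := gK (q x0); rewrite q1 q0 normr0 mulr0; lra.
have [j pj] : exists j, q x0 ord0 j != 0.
  apply: contrapT => nex; case/eqP: p0; apply/rowP => j; rewrite mxE.
  by apply/eqP/negPn/negP => pj; apply: nex; exists j.
case: r g q x0 gK gD gZ qc q1 qi p0 j pj => [|r] g q x0 gK gD gZ qc q1 qi p0 j pj.
  by case: j pj.
set p := q x0 in p0 pj *.
(* The first bound puts [q u - p] at gauge below 1, the second makes [|t| < 1] below. *)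
pose e := Num.min (K^-1 / 2) (`|p ord0 j| / 3).
have Ki : 0 < K^-1 by rewrite invr_gt0.
have pj0 : 0 < `|p ord0 j| by rewrite normr_gt0.
have e0 : 0 < e by rewrite lt_min !divr_gt0.
have eK : e <= K^-1 / 2 by rewrite ge_min lexx.
have ep : e <= `|p ord0 j| / 3 by rewrite ge_min lexx orbT.
have [d1 d10 d1P] : exists2 d1, 0 < d1 & forall x, `|x - x0| <= d1 -> `|q x - p| < e.
  have /cvgrPdist_lt/(_ e e0)/nbhs_ballP[d1 /= d10 H] := qc x0.
  exists (d1 / 2); first by rewrite divr_gt0.
  move=> x xd; rewrite distrC; apply: H; rewrite -ball_normE /= distrC.
  by apply: le_lt_trans xd _; rewrite ltr_pdivrMr // ltr_pMr // ltr1n.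
pose F (x : 'rV[R]_r.+1) : 'rV[R]_r := col' j (q x - (q x ord0 j / p ord0 j) *: p).
have Fc : continuous F.
  apply/continuous_mxP => i k; under eq_fun do rewrite mxE.
  apply: ((continuous_mxP _).1 _ i (lift j k)); apply: continuous_sub => //.
  apply: continuous_scale; last exact: cst_continuous.
  apply: continuous_mul; last exact: cst_continuous.
  exact: ((continuous_mxP _).1 qc).
have m0 : 0 < Num.min d d1 by rewrite lt_min d0.
apply: (@no_injection R r F x0 (Num.min d d1) m0 Fc) => x y.
rewrite !le_min => /andP[xd xd1] /andP[yd yd1] Fxy; apply: qi => //.
have gp u : `|u - x0| <= d1 -> g (q u - p) < 1.
  move=> /d1P h; apply: le_lt_trans (gK _) _.
  by rewrite -(mulfV (lt0r_neq0 K0)) ltr_pM2l //; lra.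
pose t := (q x ord0 j - q y ord0 j) / p ord0 j.
have E : q x = q y + t *: p.
  apply/rowP => i; rewrite !mxE; case: (unliftP j i) => [k|] ->.
    have /rowP/(_ k) := Fxy; rewrite /F !mxE => h.
    by rewrite /t mulrBl mulrBl; move: h; lra.
  by rewrite /t divfK // addrC subrK.
have t1 : `|t| < 1.
  rewrite /t normrM normfV ltr_pdivrMr // mul1r.
  have h1 := le_lt_trans (entry_le_norm _ ord0 j) (d1P _ xd1).
  have h2 := le_lt_trans (entry_le_norm _ ord0 j) (d1P _ yd1).
  have -> : q x ord0 j - q y ord0 j = (q x - p) ord0 j - (q y - p) ord0 j.
    by rewrite !mxE; ring.
  by apply: le_lt_trans (ler_normB _ _) _; lra.
have key u w s : g w = 1 -> g u = 1 -> g (u - p) < 1 -> 0 < s < 1 -> w <> u - s *: p.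
  move=> gw gu gup /andP[s0 s1] wE.
  have wE' : w = (1 - s) *: u + s *: (u - p).
    by rewrite wE scalerBl scale1r scalerBr addrA subrK.
  have : g w < 1.
    rewrite wE'; apply: le_lt_trans (gD _ _) _.
    apply: (@le_lt_trans _ _ ((1 - s) * 1 + s * g (u - p))).
      by apply: lerD; [have := gZ (1 - s) u; rewrite gu; apply; lra|apply: gZ; lra].
    have : s * g (u - p) < s * 1 by rewrite ltr_pM2l.
    lra.
  by rewrite gw ltxx.
case: (ltgtP t 0) => t0; last by rewrite E t0 scale0r addr0.
  exfalso; apply: (key (q y) (q x) (- t)) => //; first exact: gp.
    by move: t1; rewrite ltr0_norm //; lra.
  by rewrite scaleNr opprK.
exfalso; apply: (key (q x) (q y) t) => //; first exact: gp.
  by move: t1; rewrite gtr0_norm //; lra.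
by rewrite E addrK.
Qed.

Section Ball.
Variables (R : realType) (m : nat) (l : 'I_m.+1 -> R).
Hypothesis l0 : forall k, 0 < l k.
Variables (r : nat) (c : 'M[R]_m) (B : 'M[R]_(r, m * m)).
Hypotheses (cp : psd c) (c0 : \det c != 0) (Bfree : row_free B).
Hypothesis cl : forall k : 'I_m.+1, qf c (edge R m k) = l k ^+ 2.
Hypothesis BE : forall S : 'M[R]_m, (mxvec S <= B)%MS <->
  (S^T = S /\ forall k : 'I_m.+1, qf S (edge R m k) = 0).

Local Notation M d := (@Mspace R m.+1 l d).
Local Notation g := (gauge c B).

Definition gram_coords d (x : M d) : 'rV[R]_r := coordinates B (gram x - c).

Lemma gram_coords_continuous d : continuous (@gram_coords d).
Proof.
apply: (@continuous_compose _ _ _ (fun x : M d => gram x - c) (coordinates B)).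
  by apply: continuous_sub; [exact: gram_continuous|exact: cst_continuous].
exact: coordinates_continuous.
Qed.

Lemma gram_coordsE d (x : M d) : c + direction B (gram_coords x) = gram x.
Proof.
have cs : (gram x - c)^T = gram x - c by rewrite linearB /= (gram_psd x).1; case: cp => ->.
have ce (k : 'I_m.+1) : qf (gram x - c) (edge R m k) = 0.
  by rewrite qfD -scaleN1r qfZ gram_edge // cl mulN1r subrr.
by rewrite /gram_coords (coordinatesK BE cs ce) addrC subrK.
Qed.

Lemma gram_coords_gram d (x y : M d) : gram_coords x = gram_coords y -> gram x = gram y.
Proof. by move=> E; rewrite -!gram_coordsE E. Qed.

Lemma gauge_gram_coords d (x : M d) : g (gram_coords x) <= 1.
Proof. by apply: gauge_le => //; rewrite scale1r gram_coordsE; exact: gram_psd. Qed.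

Lemma gram_coords_surj d v : (m <= d)%N -> g v <= 1 -> exists x : M d, gram_coords x = v.
Proof.
move=> md gv; have [||x xE] := @gram_surj R m l l0 d (c + direction B v) md.
- by rewrite -[c]scale1r; exact: psd_pencil.
- by move=> k; rewrite qfD cl direction_edge // addr0.
by exists x; rewrite /gram_coords xE addrC addKr directionK.
Qed.

Lemma gram_coords_inj : injective (@gram_coords m.+1).
Proof. by move=> x y /gram_coords_gram; exact: gram_inj. Qed.

Lemma gram_coords_bounded : exists b, forall x : M m.+1, `|gram_coords x| <= b.
Proof.
have [|b [_ H]] := @compact_bounded R 'rV[R]_r (@gram_coords m.+1 @` [set: M m.+1]).
  apply: continuous_compact; last exact: compact_Mspace.
  by apply: continuous_subspaceT; exact: gram_coords_continuous.
exists (`|b| + 1) => x; apply: H; last by exists x.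
by apply: le_lt_trans (ler_norm _) _; rewrite ltrDl.
Qed.

(** The radial retraction [v / max (1, g v)] is lifted through the embedding [gram_coords]; [th] is
    thus defined on all of R^r, as the zero theorem requires. *)
Lemma gram_coords_section : exists2 th : 'rV[R]_r -> M m.+1, continuous th &
  forall v, g v <= 1 -> gram_coords (th v) = v.
Proof.
pose f (v : 'rV[R]_r) := (Num.max 1 (g v))^-1 *: v.
have mx0 v : 0 < Num.max 1 (g v) by rewrite lt_max ltr01.
have fc : continuous f.
  apply: continuous_scale; last exact: continuous_id.
  apply: continuous_inv => [v|]; first by rewrite gt_eqF.
  move=> v; apply: (@continuous_max R _ (fun=> 1) g v); first exact: cst_continuous.
  exact: gauge_continuous.
have [||||||th thc thE] := @compact_lift _ _ _ f (@gram_coords m.+1).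
- exact: norm_hausdorff.
- exact: compact_Mspace.
- exact: fc.
- exact: gram_coords_continuous.
- exact: gram_coords_inj.
- move=> v; apply: gram_coords_surj => //.
  rewrite gaugeZ // ?invr_gt0 // mulrC ler_pdivrMr // mul1r.
  by rewrite le_max lexx orbT.
exists th => // v gv; rewrite thE /f max_l // invr1 scale1r //.
Qed.

(** The displacement of [x - gram_coords (a (th x))] is bounded, and a zero is a coordinate vector,
    hence of gauge at most 1, where [th] is a true section. *)
Lemma Mspace_fixed_point (a : M m.+1 -> M m.+1) : continuous a -> exists x, a x = x.
Proof.
move=> ac; have [th thc thE] := gram_coords_section; have [b bP] := gram_coords_bounded.
have [||x xE] := @bounded_displacement_zero R r (fun x => x - gram_coords (a (th x))) b.
- apply: continuous_sub; first exact: continuous_id.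
  apply: (@continuous_compose _ _ _ _ (@gram_coords m.+1)); last exact: gram_coords_continuous.
  exact: (@continuous_compose _ _ _ _ a).
- by move=> x; rewrite addrC addKr normrN.
have {}xE : x = gram_coords (a (th x)) by apply/subr0_eq.
exists (th x); apply: gram_coords_inj; rewrite -xE thE // xE; exact: gauge_gram_coords.
Qed.

Lemma low_dim_not_homeo d : (0 < d < m)%N -> ~ homeomorphic (M d) (M m.+1).
Proof.
case/andP => d0 dm [h [h' [hc h'c hK h'K]]].
have [th thc thE] := gram_coords_section.
have [s sc sE] := @reflection_exists R m l l0 d d0.
have [K K0 KP] := gauge_bound cp c0 BE.
pose q (x : 'rV[R]_r) := gram_coords (h' (th x)).
pose tau (x : 'rV[R]_r) := gram_coords (h (s (h' (th x)))).
have hthc : continuous (fun x => h' (th x)) by exact: (@continuous_compose _ _ _ th h').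
have qc : continuous q.
  apply: (@continuous_compose _ _ _ _ (@gram_coords d)).
    exact: hthc.
  exact: gram_coords_continuous.
have tauc : continuous tau.
  apply: (@continuous_compose _ _ _ _ (@gram_coords m.+1)); last exact: gram_coords_continuous.
  by apply: (@continuous_compose _ _ _ _ h) => //; exact: (@continuous_compose _ _ _ _ s).
have q1 x : g (q x) = 1.
  apply/eqP; rewrite eq_le gauge_gram_coords /= leNgt; apply/negP => /(gauge_lt1_det cp c0 BE).
  by rewrite gram_coordsE /gram gram_det0 // eqxx.
have qE x y : g x <= 1 -> g y <= 1 -> q x = q y -> x = y \/ y = tau x.
  move=> gx gy /gram_coords_gram /gram_eq_orth[O OO E].
  have [dO|dO] := orth_det OO.
    have /(congr1 h) := rep_eq OO dO E; rewrite !h'K => /(congr1 (@gram_coords _)).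
    by rewrite !thE //; left.
  right; have [O' [O'O dO' E']] := sE (h' (th x)).
  have /(congr1 h) : s (h' (th x)) = h' (th y).
    apply: (@rep_eq _ _ _ _ _ _ (O'^T *m O)).
    - by rewrite trmx_mul trmxK mulmxA -(mulmxA O^T) (mulmx1C O'O) mulmx1 OO.
    - by rewrite det_mulmx det_tr dO dO' mulrNN mulr1.
    - by rewrite E E' !mulmxA -(mulmxA _ O') (mulmx1C O'O) mulmx1.
  by rewrite h'K /tau => ->; rewrite thE.
have inK x : `|x| <= K^-1 -> g x <= 1.
  by move=> xK; apply: le_trans (KP x) _; rewrite -(mulfV (lt0r_neq0 K0)) ler_pM2l.
have Ki : 0 < K^-1 by rewrite invr_gt0.
suff [x0 [e [e0 qi]]] : exists x0 e, 0 < e /\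
    forall x y, `|x - x0| <= e -> `|y - x0| <= e -> q x = q y -> x = y.
  apply: (@no_embedding_in_sphere R r g K e q x0) => //.
  - exact: gaugeD.
  - by move=> a v; exact: gaugeZ_le.
(* If [tau] is the identity near 0, both alternatives of [qE] give [x = y]. Otherwise it moves some
   [x0] by [e > 0], and for [x], [y] close to [x0] the alternative [y = tau x] is excluded by
   distance. *)
have [tauid|/existsNP[x0 /not_implyP[x0K tx0]]] :=
    pselect (forall x, `|x| < K^-1 -> tau x = x).
  exists 0, (K^-1 / 2); rewrite divr_gt0 //; split=> // x y; rewrite !subr0 => xK yK.
  have lt2 z : `|z| <= K^-1 / 2 -> `|z| < K^-1 by lra.
  move=> /qE [||//|->]; rewrite ?tauid //; try exact: lt2.
    by apply: inK; apply: ltW; exact: lt2.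
  by apply: inK; apply: ltW; exact: lt2.
have e0 : 0 < `|tau x0 - x0| by rewrite normr_gt0 subr_eq0; apply/eqP.
set e := `|tau x0 - x0| in e0.
have e20 : 0 < e / 2 by rewrite divr_gt0.
have /cvgrPdist_lt/(_ _ e20)/nbhs_ballP[d1 /= d10 H] := tauc x0.
pose d2 := Num.min (d1 / 2) (Num.min (e / 2) (K^-1 - `|x0|)).
have d20 : 0 < d2 by rewrite !lt_min e20 subr_gt0 x0K divr_gt0.
exists x0, d2; split=> // x y.
rewrite !le_min => /and3P[x1 x2 x3] /and3P[y1 y2 y3].
have near0 z : `|z - x0| <= K^-1 - `|x0| -> g z <= 1.
  move=> zx; apply: inK; rewrite -[z](subrK x0); apply: le_trans (ler_normD _ _) _; lra.
move=> /qE[||//|yE]; [exact: near0|exact: near0|exfalso].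
have : `|tau x0 - tau x| < e / 2.
  by apply: H; rewrite -ball_normE /= distrC; lra.
rewrite -yE => lt_tau.
have : e <= `|tau x0 - y| + `|y - x0| by exact: ler_distD.
lra.
Qed.


(** * Dimension n - 1 *)

Section Double.
Hypothesis m0 : (0 < m)%N.

(* (gram_coords x, height x) embeds M_m onto the sphere gauge v + |s| = 1. *)
Definition height (x : M m) : R := Num.sg (\det (rep x)) * (1 - g (gram_coords x)).

Lemma det_gauge1 (x : M m) : \det (rep x) = 0 -> g (gram_coords x) = 1.
Proof.
move=> dx; apply/eqP; rewrite eq_le gauge_gram_coords /= leNgt.
apply/negP => /(gauge_lt1_det cp c0 BE).
by rewrite gram_coordsE /gram gram_det dx expr0n eqxx.
Qed.

Lemma gauge1_det (x : M m) : g (gram_coords x) = 1 -> \det (rep x) = 0.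
Proof.
move=> gx; apply/eqP/negPn/negP => dx.
have : g (gram_coords x) < 1.
  apply: (det_gauge_lt1 cp c0 BE); first by rewrite gx.
  by rewrite gram_coordsE /gram gram_det expf_eq0.
by rewrite gx ltxx.
Qed.

Lemma height_continuous : continuous height.
Proof.
apply: continuous_sgr_mul.
- apply: (@invariant_continuous _ _ _ _ _ (fun P : 'M[R]_m => \det P)).
    by apply: continuous_det; exact: continuous_id.
  by move=> P O OO dO; rewrite det_mulmx dO mulr1.
- apply: (@continuous_sub R _ R^o); first exact: cst_continuous.
  apply: (@continuous_compose _ _ _ (@gram_coords m) g); first exact: gram_coords_continuous.
  exact: gauge_continuous.
- by move=> x /det_gauge1 ->; rewrite subrr.
Qed.

Lemma norm_height x : `|height x| = 1 - g (gram_coords x).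
Proof.
rewrite /height normrM normr_sg ger0_norm ?subr_ge0 ?gauge_gram_coords //.
by case: eqP => [/det_gauge1 ->|_]; rewrite ?mul1r // subrr mulr0.
Qed.

(** On the gauge sphere the vertices do not span, so a reflection corrects the determinant; inside
    it the sign of [height] rules out determinant -1. *)
Lemma double_inj (x y : M m) : gram_coords x = gram_coords y -> height x = height y -> x = y.
Proof.
move=> rE hE; have gE := gram_coords_gram rE.
have [g1|g1] := eqVneq (g (gram_coords x)) 1.
  have dx := gauge1_det g1.
  have [|O [OO dO E]] := gram_eq_rotation gE; last exact: rep_eq OO dO E.
  rewrite ltnNge; apply/negP => rk.
  have : rep x \in unitmx by rewrite -row_free_unit /row_free eqn_leq rank_leq_row.
  by rewrite unitmxE dx unitr0.
have [O OO E] := gram_eq_orth gE.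
have [dO|dO] := orth_det OO; first exact: rep_eq OO dO E.
have dx : \det (rep x) != 0 by apply: contra_neq g1; exact: det_gauge1.
move: hE; rewrite /height -rE E det_mulmx dO mulrN1 sgrN mulNr => /eqP.
rewrite -addr_eq0 -mulr2n mulrn_eq0 /= mulf_eq0 sgr_eq0 (negbTE dx) subr_eq0.
by rewrite eq_sym (negbTE g1).
Qed.

Lemma double_surj v s : g v + `|s| = 1 -> exists x : M m, gram_coords x = v /\ height x = s.
Proof.
move=> vs; have [||x xE] := @gram_coords_surj m v; first by [].
  by rewrite -vs lerDl.
have hx : `|height x| = `|s| by rewrite norm_height xE; lra.
have [e|e] : height x = s \/ height x = - s.
  by move/eqP: hx; rewrite eqr_norm2 => /orP[] /eqP; [left|right].
  by exists x.
have [f _ fE] := @reflection_exists R m l l0 m m0.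
exists (f x); have [O [OO dO E]] := fE x.
have rE : gram_coords (f x) = gram_coords x by rewrite /gram_coords /gram E gram_orth.
split; first by rewrite rE.
by rewrite -[s]opprK -e /height rE E det_mulmx dO mulrN1 sgrN mulNr.
Qed.

Lemma double_not_homeo : ~ homeomorphic (M m) (M m.+1).
Proof.
case=> h [h' [hc h'c hK h'K]].
pose psi (x : M m) : 'rV[R]_r * R := (gram_coords x, height x).
pose N (x : M m) : R := g (- gram_coords x) + `|height x|.
(* Both terms vanish only at coordinates 0, but there the height has absolute value 1. *)
have N0 x : 0 < N x.
  rewrite lt_def addr_ge0 ?gauge_ge0 // andbT; apply/eqP => Nx.
  have gx := gauge_ge0 cp c0 BE (- gram_coords x); have hx := normr_ge0 (height x).
  have h0 : `|height x| = 0 by rewrite /N in Nx; lra.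
  have g0 : g (- gram_coords x) = 0 by rewrite /N in Nx; lra.
  have [r0|r0] := eqVneq (- gram_coords x) 0; last first.
    by have := gauge_gt0 cp c0 Bfree BE r0; rewrite g0 ltxx.
  move: h0; rewrite norm_height; move/eqP: r0; rewrite oppr_eq0 => /eqP ->.
  rewrite (gauge0 cp c0 BE); lra.
pose A (x : M m) : 'rV[R]_r * R := ((N x)^-1 *: - gram_coords x, - ((N x)^-1 * height x)).
have gram_coordsc := @gram_coords_continuous m.
have heightc := height_continuous.
have Nc : continuous N.
  apply: (@continuous_add R _ R^o).
    apply: (@continuous_compose _ _ _ (fun x => - gram_coords x) g).
      exact: continuous_opp.
    exact: gauge_continuous.
  apply: (@continuous_compose _ _ _ height (fun t : R^o => `|t|)) => //.
  exact: norm_continuous.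
have Nic : continuous (fun x => (N x)^-1).
  by apply: continuous_inv => // x; rewrite gt_eqF.
have psic : continuous psi by exact: continuous_pair.
have Ac : continuous A.
  apply: continuous_pair.
    by apply: continuous_scale => //; exact: continuous_opp.
  by apply: (@continuous_opp R _ R^o); exact: continuous_mul.
have [|||||x|a ac aE] := @compact_lift _ _ _ A psi.
- exact: norm_hausdorff.
- exact: compact_Mspace.
- exact: Ac.
- exact: psic.
- by move=> x y E; exact: (double_inj (congr1 fst E) (congr1 snd E)).
- have [|y [yr yh]] := @double_surj ((N x)^-1 *: - gram_coords x) (- ((N x)^-1 * height x)).
    rewrite normrN normrM (gtr0_norm (_ : 0 < (N x)^-1)) ?invr_gt0 //.
    by rewrite gaugeZ // ?invr_gt0 // -mulrDr mulVf // gt_eqF.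
  by exists y; rewrite /psi yr yh.
have hac : continuous (fun x => h (a (h' x))).
  apply: (@continuous_compose _ _ _ _ h) => //.
  exact: (@continuous_compose _ _ _ h' a).
have [y yE] := Mspace_fixed_point hac.
have ay : a (h' y) = h' y by rewrite -{2}yE hK.
have := aE (h' y); rewrite ay; set x := h' y => E.
have rE : gram_coords x = (N x)^-1 *: - gram_coords x := congr1 fst E.
have hE : height x = - ((N x)^-1 * height x) := congr1 snd E.
(* Both components of a fixed point are killed by [1 + (N x)^-1], which would put the origin on the
   sphere. *)
have Ni : 0 < 1 + (N x)^-1 by rewrite addr_gt0 ?invr_gt0.
have r0 : gram_coords x = 0.
  apply/eqP; have : (1 + (N x)^-1) *: gram_coords x = 0.
    by rewrite scalerDl scale1r {1}rE scalerN addNr.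
  by move/eqP; rewrite scaler_eq0 gt_eqF.
have h0 : height x = 0.
  have : (1 + (N x)^-1) * height x = 0 by rewrite mulrDl mul1r {1}hE addNr.
  by move/eqP; rewrite mulf_eq0 gt_eqF // => /eqP.
by have := norm_height x; rewrite h0 r0 (gauge0 cp c0 BE) normr0; lra.
Qed.

End Double.
End Ball.

Theorem theorem5p3 (R : realType) (n : nat) (l : 'I_n -> R) :
  (3 <= n)%N -> int_Cn l ->
  forall d : nat, (2 <= d)%N ->
    (homeomorphic (Mspace l d) (Mspace l n) <-> (n <= d)%N).
Proof.
case: n l => // m l m2 lC d d2.
have l0 k : 0 < l k by exact: (lC k).1.
split; last by move=> md; exact: high_dim_homeo.
move=> hM; rewrite leqNgt; apply/negP => dm.
have [c [cp c0 cl]] := exists_center m2 lC.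
have [r [B [Bfree BE]]] := exists_directions R m.
move: dm hM; rewrite ltnS leq_eqVlt => /orP[/eqP ->|dm].
  exact: (double_not_homeo l0 cp c0 Bfree cl BE (ltnW (m2 : (1 < m)%N))).
by apply: (low_dim_not_homeo l0 cp c0 Bfree cl BE); rewrite dm andbT ltnW.
Qed.
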